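(* Let $G$ be an $n$-vertex, $K_{r+1}$-free graph where $r \ge 3$. Let $t \ge 2$. (a) If $G$ is not traceable and $n \ge 20$ if $r=3$, $n\ge 1$ if $r\ge 4$, then $k^t(G) \leq k^t(G^{-1*}_{n,r})$. Equality holds if $G \cong G^{-1*}_{n,r}$, which is $T_r(n-1)$ plus an isolated vertex. (b) If $G$ is not Hamiltonian (or, for $n\ge 4$, if $G$ is not chorded pancyclic) and $n \ge 26$ if $r=3$, $n\ge 11$ if $r=4$, $n\ge 2$ if $r \ge 5$, then $k^t(G) \leq k^t(G^{0*}_{n,r})$. Equality holds if $G \cong G^{0*}_{n,r}$, which is $T_r(n-1)$ plus a vertex of degree $1$. (c) If $G$ is not Hamiltonian-connected and $n \ge 32$ if $r=3$, $n\ge 16$ if $r=4$, $n\ge 10$ if $r=5$, $n\ge 4$ if $r \ge 6$, then $k^t(G) \leq k^t(G^{1*}_{n,r})$. Equality holds if $G \cong G^{1*}_{n,r}$, which is $T_r(n-1)$ plus a vertex of degree $2$ whose neighbors are adjacent. (d) For $k\ge 0$, if $G$ is not $k$-path Hamiltonian and $n \ge 6k+26$ if $r=3$, $n\ge 5k+11$ if $4 \le r \le 7$, $n\ge k+5+ 4(k+4)/(r-4)$ if $r \ge 8$, then $k^t(G) \leq k^t(G^{k*}_{n,r})$. Equality holds if $G \cong G^{k*}_{n,r}$. (e) For $k\ge 0$, if $G$ is not $k$-Hamiltonian and $n \ge 6k+26$ if $r=3$, $n\ge 5k+11$ if $4 \le r \le 7$, $n\ge k+5+ 4(k+4)/(r-4)$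 if $r \ge 8$, then $k^t(G) \leq k^t(G^{k*}_{n,r})$. Equality holds if $G \cong G^{k*}_{n,r}$. (f) For $k\ge 1$, if $G$ is not $k$-Hamiltonian-connected and $n \ge 6k+26$ if $r=3$, $n\ge 5k+11$ if $r=4$, $n\ge 3k+7$ if $5 \le r \le 7$, $n\ge k+5+4(k+4)/(r-4)$ if $r \ge 8$, then $k^t(G) \leq k^t(G^{k*}_{n,r})$. Equality holds if $G \cong G^{k*}_{n,r}$. (g) For $k\ge 1$, if $G$ is not $k$-connected and $n \ge 6k+14$ if $r=3$, $n\ge 5k+1$ if $4 \le r \le 7$, $n\ge 2k+5$ if $r \ge 8$, then $k^t(G) \leq k^t(G^{(k-2)*}_{n,r})$. Equality holds if $G \cong G^{(k-2)*}_{n,r}$.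
   Context: Graphs are finite and simple; $n,r,k,t$ are integers. A $t$-clique is a set of $t$ pairwise adjacent vertices; $k^t(G)$ denotes the number of $t$-cliques in $G$ (the superscript notation $k^t$ is unrelated to the integer parameter $k$). $T_r(n)$ is the $n$-vertex, $r$-partite Turán graph: the complete $r$-partite graph on $n$ vertices with part sizes differing by at most 1 (if $n<r$ some parts are empty and it is $K_n$). For $-1 \le \ell \le \lceil (r-1)(n-1)/r\rceil-1$, $G^{\ell*}_{n,r}$ denotes the graph formed from $T_r(n-1)$ by adding a new vertex $x$ such that the (subgraph induced by the) neighborhood of $x$ is isomorphic to $T_{r-1}(\ell+1)$ and disjoint from a smallest part of the $T_r(n-1)$. A graph is traceable if it contains a Hamiltonian path, Hamiltonian if it contains a Hamiltonian cycle, and Hamiltonian-connected if every pair of distinct vertices is connected by a Hamiltonian path. An $n$-vertex graph is chorded pancyclic if it contains a chorded cycle (a cycle with at least one chord) of every length from $4$ to $n$. An $n$-vertex graph $G$ is $k$-path Hamiltonian ($0 \le k \le n-2$) if every path of length at most $k$ is contained in a Hamiltonian cycle; $k$-Hamiltonian ($0\le k\le n-3$) if for each set $S$ of at most $k$ vertices $G-S$ is Hamiltonian; $k$-Hamiltonian-connected ($1\le k\le n-2$) if for each set $S$ of fewer than $k$ vertices $G-S$ is Hamiltonian-connected; $k$-connected ($1\le k\le n-1$) if for each set $S$ of fewer than $k$ vertices $G-S$ is connected. *)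

(* Defs.v *)
From HB Require Import structures.
From mathcomp Require Import all_boot all_order all_algebra.
From mathcomp Require Import zify.

Set Implicit Arguments.
Unset Strict Implicit.
Unset Printing Implicit Defensive.

Import Order.TTheory GRing.Theory Num.Theory.

Record sgraph := SGraph {
  vertex :> finType;
  edge : rel vertex;
  edge_sym : symmetric edge;
  edge_irrefl : irreflexive edge
}.

Definition nbh (G : sgraph) (x : G) : {set G} := [set y | edge x y].

Definition is_iso (G H : sgraph) (f : G -> H) : Prop :=
  bijective f /\ forall x y, edge (f x) (f y) = edge x y.

Definition isomorphic (G H : sgraph) : Prop := exists f : G -> H, is_iso f.

Section Induced.
Variables (G : sgraph) (A : {set G}).

Definition induced_rel : rel {x : G | x \in A} :=
  fun x y => edge (val x) (val y).

Lemma induced_sym : symmetric induced_rel.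
Proof. by move=> x y; exact: edge_sym. Qed.

Lemma induced_irrefl : irreflexive induced_rel.
Proof. by move=> x; exact: edge_irrefl. Qed.

Definition induced : sgraph := SGraph induced_sym induced_irrefl.

End Induced.

Definition del (G : sgraph) (S : {set G}) : sgraph := induced (~: S).

Definition clique (G : sgraph) (K : {set G}) : bool :=
  [forall x in K, forall y in K, (x != y) ==> edge x y].

Definition num_cliques (t : nat) (G : sgraph) : nat :=
  #|[set K : {set G} | (#|K| == t) && clique K]|.

Definition clique_free (s : nat) (G : sgraph) : Prop :=
  forall K : {set G}, clique K -> #|K| <> s.

Definition is_path (G : sgraph) (s : seq G) : bool :=
  [&& s != [::], uniq s & sorted (@edge G) s].

Definition is_cycle (G : sgraph) (c : seq G) : bool :=
  [&& 2 < size c, uniq c & cycle (@edge G) c].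

(* [u] and [v] are the endpoints of an edge of the cycle [c]. *)
Definition cycle_edge (G : sgraph) (c : seq G) : rel G :=
  fun u v => [&& u \in c, v \in c & (next c u == v) || (next c v == u)].

Definition spanning (G : sgraph) (s : seq G) : Prop := forall v : G, v \in s.

Definition ham_path (G : sgraph) (s : seq G) : Prop := is_path s /\ spanning s.

Definition ham_cycle (G : sgraph) (c : seq G) : Prop := is_cycle c /\ spanning c.

Definition traceable (G : sgraph) : Prop := exists s : seq G, ham_path s.

Definition hamiltonian (G : sgraph) : Prop := exists c : seq G, ham_cycle c.

Definition hamiltonian_connected (G : sgraph) : Prop :=
  forall u v : G, u != v ->
  exists p : seq G, ham_path (u :: p) /\ last u p = v.

Definition chorded_cycle (G : sgraph) (c : seq G) : Prop :=
  is_cycle c /\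
  exists u v : G, [&& u \in c, v \in c, edge u v & ~~ cycle_edge c u v].

Definition chorded_pancyclic (G : sgraph) : Prop :=
  forall m, 4 <= m <= #|G| ->
  exists c : seq G, chorded_cycle c /\ size c = m.

(* The path [s] is a subgraph of the cycle [c].  The length of a path is its
   number of edges, [(size s).-1]. *)
Definition path_in_cycle (G : sgraph) (s c : seq G) : Prop :=
  {subset s <= c} /\ sorted (cycle_edge c) s.

Definition path_hamiltonian (k : nat) (G : sgraph) : Prop :=
  forall s : seq G, is_path s -> (size s).-1 <= k ->
  exists c : seq G, ham_cycle c /\ path_in_cycle s c.

Definition k_hamiltonian (k : nat) (G : sgraph) : Prop :=
  forall S : {set G}, #|S| <= k -> hamiltonian (del S).

Definition k_hamiltonian_connected (k : nat) (G : sgraph) : Prop :=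
  forall S : {set G}, #|S| < k -> hamiltonian_connected (del S).

Definition connected_graph (G : sgraph) : Prop :=
  forall x y : G, connect (@edge G) x y.

Definition k_connected (k : nat) (G : sgraph) : Prop :=
  forall S : {set G}, #|S| < k -> connected_graph (del S).

(* The parts of [turan r n] are the residue classes modulo [r], for [0 < r]. *)
Definition turan_rel (r n : nat) : rel 'I_n := fun i j => i %% r != j %% r.

Lemma turan_sym r n : symmetric (@turan_rel r n).
Proof. by move=> i j; rewrite /turan_rel eq_sym. Qed.

Lemma turan_irrefl r n : irreflexive (@turan_rel r n).
Proof. by move=> i; rewrite /turan_rel eqxx. Qed.

Definition turan (r n : nat) : sgraph :=
  SGraph (@turan_sym r n) (@turan_irrefl r n).

Definition turan_part (r n : nat) (j : 'I_r) : {set turan r n} :=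
  [set i : 'I_n | i %% r == j].

Definition smallest_part (r n : nat) (j : 'I_r) : Prop :=
  forall j' : 'I_r, #|turan_part n j| <= #|turan_part n j'|.

Section Gstar.
Local Open Scope ring_scope.

Definition Gstar_range (n r : nat) (l : int) : Prop :=
  -1 <= l <= Num.ceil ((r%:R - 1) * (n%:R - 1) / r%:R : rat) - 1.

(* [Gstar n r l H] says that [H] is a graph [G^{l*}_{n,r}], with added vertex
   [x] and [f] identifying [H - x] with [turan r n.-1].  It is a predicate
   because the construction does not fix which parts of the Turan graph contain
   the larger parts of the neighbourhood of [x]. *)
Definition Gstar (n r : nat) (l : int) (H : sgraph) : Prop :=
  [/\ Gstar_range n r l,
      #|H| = n &
      exists (x : H) (f : del [set x] -> turan r n.-1),
        [/\ is_iso f,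
            isomorphic (induced (nbh x)) (turan r.-1 `|l + 1|) &
            exists2 j : 'I_r, smallest_part n.-1 j &
              forall y : del [set x],
                val y \in nbh x -> f y \notin turan_part n.-1 j]].

End Gstar.

Definition turan_plus_vertex (n r : nat) (H : sgraph) (P : {set H} -> Prop) :
  Prop :=
  exists x : H, isomorphic (del [set x]) (turan r n.-1) /\ P (nbh x).

(* [ext_graph] joins the new vertex [None] to the first [d] vertices of
   [turan r m] lying outside the last part. *)
Section GstarExists.
Variables (r m d : nat).
Hypotheses (r3 : 3 <= r) (dm : d <= m - m %/ r).

Definition ext_nbr (i : 'I_m) : bool :=
  (i %% r < r.-1) && (i %/ r * r.-1 + i %% r < d).

Definition ext_rel : rel (option 'I_m) := fun a b =>
  match a, b with
  | Some i, Some j => turan_rel r i j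
  | Some i, None | None, Some i => ext_nbr i
  | None, None => false
  end.

Lemma ext_sym : symmetric ext_rel.
Proof. by case=> [i|] [j|] //=; rewrite turan_sym. Qed.

Lemma ext_irrefl : irreflexive ext_rel.
Proof. by case=> [i|] //=; rewrite turan_irrefl. Qed.

Definition ext_graph : sgraph := SGraph ext_sym ext_irrefl.

Let x : ext_graph := None.

Lemma ext_del_in (i : 'I_m) : (Some i : ext_graph) \in ~: [set x].
Proof. by rewrite !inE. Qed.

Definition ext_inv (i : turan r m) : del [set x] := Sub (Some i) (ext_del_in i).

Lemma ext_f_subproof (y : del [set x]) : {i : 'I_m | val y = Some i}.
Proof.
case: y => -[i|] /= h; first by exists i.
by exfalso; rewrite !inE eqxx in h.
Qed.

Definition ext_f (y : del [set x]) : turan r m := sval (ext_f_subproof y).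

Lemma ext_fE y : val y = Some (ext_f y).
Proof. exact: (svalP (ext_f_subproof y)). Qed.

Lemma ext_f_iso : is_iso ext_f.
Proof.
split.
  exists ext_inv => [y | i]; first by apply: val_inj; rewrite [RHS]ext_fE.
  by have := ext_fE (ext_inv i) => -[].
by move=> y z; rewrite [RHS]/= /induced_rel !ext_fE.
Qed.

Lemma ext_nbr_subproof (j : 'I_d) : j %/ r.-1 * r + j %% r.-1 < m.
Proof.
have := ltn_ord j; have := divn_eq j r.-1; have := divn_eq m r.
have : j %% r.-1 < r.-1 by apply: ltn_pmod; lia.
have : m %% r < r by apply: ltn_pmod; lia.
move: dm; set a := j %/ _; set b := j %% _; set q := m %/ _; set s := m %% _.
move=> hd hs hb hm hj hjd.
have h : a * r.-1 + b < q * r.-1 + s by nia.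
case: (ltngtP a q) => haq; [by nia | by nia | subst a; nia].
Qed.

Definition ext_ord (j : 'I_d) : 'I_m := Ordinal (ext_nbr_subproof j).

Lemma ext_ord_modn j : ext_ord j %% r = j %% r.-1.
Proof.
have h : j %% r.-1 < r.-1 by apply: ltn_pmod; lia.
by rewrite /= modnMDl modn_small //; lia.
Qed.

Lemma ext_ord_divn j : ext_ord j %/ r = j %/ r.-1.
Proof.
have h : j %% r.-1 < r.-1 by apply: ltn_pmod; lia.
have h' : j %% r.-1 < r by lia.
rewrite /= divnMDl; last by lia.
by rewrite (divn_small h') addn0.
Qed.

Lemma ext_ordP j : (Some (ext_ord j) : ext_graph) \in nbh x.
Proof.
rewrite inE /= /ext_nbr ext_ord_modn ext_ord_divn -divn_eq ltn_ord andbT.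
by apply: ltn_pmod; lia.
Qed.

Lemma ext_g_subproof (y : induced (nbh x)) :
  {j : 'I_d | val y = Some (ext_ord j)}.
Proof.
case: y => -[i|] /= hy; last by exfalso; rewrite inE in hy.
have /andP[h1 h2] : ext_nbr i by rewrite inE in hy.
exists (Ordinal h2); congr Some; apply: val_inj => /=.
rewrite modnMDl divnMDl; last by lia.
by rewrite (divn_small h1) addn0 modn_small // -divn_eq.
Qed.

Definition ext_g (y : induced (nbh x)) : turan r.-1 d := sval (ext_g_subproof y).

Lemma ext_gE y : val y = Some (ext_ord (ext_g y)).
Proof. exact: (svalP (ext_g_subproof y)). Qed.

Lemma ext_ord_inj : injective ext_ord.
Proof.
move=> i j e; apply: val_inj => /=.
by rewrite (divn_eq i r.-1) (divn_eq j r.-1) -!ext_ord_modn -!ext_ord_divn e.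
Qed.

Definition ext_g_inv (j : turan r.-1 d) : induced (nbh x) :=
  Sub (Some (ext_ord j)) (ext_ordP j).

Lemma ext_g_iso : is_iso ext_g.
Proof.
split.
  exists ext_g_inv => [y | j].
    by apply: val_inj; rewrite [RHS]ext_gE.
  by apply: ext_ord_inj; apply: Some_inj; rewrite -ext_gE.
move=> y z; rewrite [RHS]/= /induced_rel !ext_gE.
by rewrite /edge /= /turan_rel !ext_ord_modn.
Qed.

Lemma ext_last_subproof : r.-1 < r. Proof. by lia. Qed.

Definition ext_last : 'I_r := Ordinal ext_last_subproof.

Lemma ext_last_smallest : smallest_part m ext_last.
Proof.
move=> j'; pose f (i : 'I_m) : 'I_m := insubd i (i - r.-1 + j').
have hj' := ltn_ord j'.
have fE (i : 'I_m) : i %% r = r.-1 -> f i = i %/ r * r + j' :> nat.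
  move=> hi; have := divn_eq i r; rewrite hi => e.
  move: e (ltn_ord i) hj'; rewrite val_insubd.
  move: (i %/ r * r) => q; move: (nat_of_ord i) (nat_of_ord j') => a b e am br.
  by rewrite ifT; lia.
have f_inj : {in turan_part m ext_last &, injective f}.
  move=> i1 i2; rewrite !inE => /eqP h1 /eqP h2 /(congr1 val).
  rewrite /= !fE // => /eqP; rewrite eqn_add2r => /eqP e.
  by apply: val_inj; rewrite /= (divn_eq i1 r) (divn_eq i2 r) e h1 h2.
rewrite -[leqLHS](card_in_imset f_inj); apply: subset_leq_card.
apply/subsetP=> _ /imsetP[i hi ->]; move: hi; rewrite !inE => /eqP hi.
by rewrite fE // modnMDl modn_small.
Qed.

End GstarExists.

Lemma Gstar_exists (n r : nat) (l : int) :
  0 < n -> 3 <= r -> Gstar_range n r l -> exists H, Gstar n r l H.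
Proof.
case: n => // m _ r3 hl; have [l1 l2] := andP hl.
have dm : `|(l + 1)%R|%N <= m - m %/ r.
  have hl0 : (0 <= l + 1)%R by lia.
  have : (l < Num.ceil ((r%:R - 1) * (m.+1%:R - 1) / r%:R : rat))%R by lia.
  have r0 : (0 < r%:R :> rat)%R by rewrite ltr0n; lia.
  rewrite ceil_gt_int ltr_pdivlMr // => h.
  have {h} : ((l * r%:Z)%:~R < ((r%:Z - 1) * (m.+1%:Z - 1))%:~R :> rat)%R.
    by rewrite !(intrM, intrB).
  rewrite ltr_int => h.
  have := divn_eq m r; have : m %% r < r by apply: ltn_pmod; lia.
  set q := m %/ r; set s := m %% r => hs hm.
  have : (l * r%:Z < (r%:Z - 1) * (q%:Z * r%:Z + s%:Z))%R by lia.
  have : (l + 1 <= m%:Z - q%:Z)%R -> `|(l + 1)%R|%N <= m - q by lia.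
  move=> h1 h2; apply: h1; nia.
exists (ext_graph r m `|(l + 1)%R|%N); split=> //.
  by rewrite card_option card_ord.
exists None, (@ext_f r m `|(l + 1)%R|%N); split.
- exact: ext_f_iso.
- by exists (ext_g r3 dm); exact: ext_g_iso.
- exists (ext_last r3 dm); first exact: ext_last_smallest.
  move=> y; rewrite ext_fE !inE /= /ext_nbr => /andP[h _].
  by rewrite neq_ltn h.
Qed.

(* Main.v *)
Require Import Defs.
From mathcomp Require Import all_boot all_order all_algebra.
From mathcomp Require Import zify.
From Stdlib Require Import Classical.

(* Put q = l + 1.  The extremal graph has at least k^t(T_r(n-1)) +
   k^(t-1)(T_(r-1)(q)) t-cliques.  If G fails one of the properties, an argument
   of Posa gives some i with 2i + q <= n and i vertices of degree less than
   i + q.  For every j <= i, deleting j of them and using Zykov's theorem on the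
   rest and on the neighbourhoods bounds k^t(G) by
   k^t(T_r(n-j)) + j k^(t-1)(T_(r-1)(i+q-1)).  Since d |-> k^(t-1)(T_(r-1)(d)) is
   convex, comparing this with the extremal value reduces to the case t = 2, a
   linear inequality, which a suitable j (not always j = i) satisfies in the
   stated ranges of n.
   For chorded pancyclicity, a graph with more cliques than the extremal one has
   a vertex v and a cycle avoiding v and at most one other vertex, such that v is
   adjacent to more than 3/5 of the cycle; chorded cycles of all lengths from 5
   on are then found through v. *)

Import Order.TTheory GRing.Theory Num.Theory.

Set Implicit Arguments.
Unset Strict Implicit.
Unset Printing Implicit Defensive.

(** Convexity removes t as follows. Over T_r(n-j), the extremal graph gains one link for each of the
    j-1 vertices completing T_r(n-1), with degrees [tdeg r x], and one with q vertices for the added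
    vertex; G gains at most j links of i+q-1 vertices. The j equal terms lie on the tangent line at
    i+q-1, whose slope is nonnegative, so comparing the sums of the degrees is enough, and these do
    not involve t. For r = 3 and i near n/2, the choice j = i makes both sides of that comparison
    n^2/4 to leading order, while a bounded j leaves a margin linear in n. Chorded pancyclicity
    meets another obstacle: many cliques give Posa's condition for q = 1, and deleting v uses up
    this 1, so it does not make G-v Hamiltonian. Let u have minimum degree among the other vertices.
    If its degree is large, a Dirac-type condition holds in G-v. Otherwise u is itself one more
    vertex of low degree, and deleting it before the others gives the room to prove Posa's condition
    in G-u-v. *)

(** * Counting cliques *)

(* The minimum degree of [turan r x.+1]. *)
Definition tdeg (r x : nat) : nat := x - x %/ r.

(* The number of t-cliques of [turan r m]: its vertex [x] has [tdeg r x] smaller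
   neighbours, which induce [turan r.-1 (tdeg r x)]. *)
Fixpoint tcl (t r m : nat) : nat :=
  if t is t'.+1 then \sum_(x < m) tcl t' r.-1 (tdeg r x) else 1.

Lemma tclE t r m : tcl t.+1 r m = \sum_(x < m) tcl t r.-1 (tdeg r x).
Proof. by []. Qed.

Arguments tcl : simpl never.

Lemma tclS t r m : tcl t.+1 r m.+1 = tcl t.+1 r m + tcl t r.-1 (tdeg r m).
Proof. by rewrite !tclE big_ord_recr. Qed.

Lemma tclS0 t r : tcl t.+1 r 0 = 0.
Proof. by rewrite tclE big_ord0. Qed.

Lemma tcl1 r m : tcl 1 r m = m.
Proof. by rewrite tclE sum1_card card_ord. Qed.

Lemma tdegS r x : tdeg r x <= tdeg r x.+1 <= (tdeg r x).+1.
Proof.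
rewrite /tdeg; case: r => [|r]; first by rewrite !divn0; lia.
have h1 : x %/ r.+1 <= x.+1 %/ r.+1 by apply: leq_div2r.
have h2 : x.+1 %/ r.+1 <= (x %/ r.+1).+1.
  have := divn_eq x r.+1; have := ltn_pmod x (ltn0Sn r).
  set a := x %/ _; set b := _ %% _ => hb e.
  by rewrite -ltnS ltn_divLR //; lia.
have : x %/ r.+1 <= x by apply: leq_div.
lia.
Qed.

Lemma tdeg_mono r x y : x <= y -> tdeg r x <= tdeg r y.
Proof.
apply: (homo_leq leqnn leq_trans) => {}x.
by case/andP: (tdegS r x).
Qed.

Lemma tcl_mono t r x y : x <= y -> tcl t r x <= tcl t r y.
Proof.
case: t => [|t] //; apply: (homo_leq leqnn leq_trans) => {}x.
by rewrite tclS leq_addr.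
Qed.

(* Convexity of [tcl t.+1 r], stated without subtraction as the tangent-line
   inequality at [D]. *)
Lemma tcl_tangent t r D x :
  tcl t.+1 r D + tcl t r.-1 (tdeg r D) * x <=
  tcl t.+1 r x + tcl t r.-1 (tdeg r D) * D.
Proof.
pose s d := tcl t r.-1 (tdeg r d); rewrite -/(s D).
have smono a b : a <= b -> s a <= s b by move=> ?; apply/tcl_mono/tdeg_mono.
case: (leqP D x) => h.
  rewrite -(subnKC h); elim: (x - D) => [|k IH]; first by rewrite addn0.
  rewrite addnS tclS -/(s _) mulnS.
  have := smono D (D + k) (leq_addr _ _); lia.
move: (ltnW h) => {}h.
suff H k : k <= D -> tcl t.+1 r D + s D * (D - k) <= tcl t.+1 r (D - k) + s D * D.
  by have := H (D - x) (leq_subr _ _); rewrite subKn.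
elim: k => [|k IH] hk; first by rewrite subn0.
have := IH (ltnW hk); have -> : D - k = (D - k.+1).+1 by lia.
rewrite tclS -/(s _) mulnS.
have := smono (D - k.+1) D (leq_subr _ _); lia.
Qed.

(** The points on the left are [b - a] copies of [D] and one [D + e]. For [e <= 1] all of them lie
    on the tangent line at [D], whose slope is the next increment of [tcl]. The points on the right
    have at least the same sum, and by convexity their values lie on or above that line. *)
Lemma tcl_jensen t r p a b q D e : a <= b -> e <= 1 ->
  (b - a).+1 * D + e <= \sum_(a <= x < b) tdeg p x + q ->
  (b - a) * tcl t.+1 r D + tcl t.+1 r (D + e) <=
  \sum_(a <= x < b) tcl t.+1 r (tdeg p x) + tcl t.+1 r q.
Proof.
move=> ab e1 h; set s := tcl t r.-1 (tdeg r D).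
have -> : tcl t.+1 r (D + e) = tcl t.+1 r D + s * e.
  by case: e e1 {h} => [|[|]] // _; rewrite ?addn0 ?addn1 ?tclS ?muln0 ?muln1 ?addn0.
have hq := tcl_tangent t r D q; rewrite -/s in hq.
have : \sum_(a <= x < b) (tcl t.+1 r D + s * tdeg p x) <=
       \sum_(a <= x < b) (tcl t.+1 r (tdeg p x) + s * D).
  by apply: leq_sum => x _; exact: tcl_tangent.
rewrite !big_split /= -!big_distrr /= !sum_nat_const_nat.
have : s * ((b - a).+1 * D + e) <= s * (\sum_(a <= x < b) tdeg p x + q).
  by rewrite leq_mul2l h orbT.
rewrite mulSn; set S1 := \sum_(_ <= _ < _) tdeg _ _ in h *.
set S2 := \sum_(_ <= _ < _) _; move: hq; set g := tcl _ _ D; set g' := tcl _ _ q.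
move: (b - a) => k; clear; nia.
Qed.

Lemma tcl_range t r a b : a <= b ->
  tcl t.+1 r b = tcl t.+1 r a + \sum_(a <= x < b) tcl t r.-1 (tdeg r x).
Proof.
move=> ab; rewrite !tclE -!(big_mkord xpredT (fun x => tcl t r.-1 (tdeg r x))).
by rewrite -big_cat_nat.
Qed.

Lemma tdeg_le r r' x : 0 < r <= r' -> tdeg r x <= tdeg r' x.
Proof. by move=> /andP[h1 h2]; apply: leq_sub2l; apply: leq_div2l. Qed.

Section Counting.
Variable G : sgraph.
Implicit Types (A B J K : {set G}) (v : G).

(** Cliques are counted inside a vertex set, so that deleting vertices and passing to links stays
    within one graph. *)
Definition kset t A : {set {set G}} :=
  [set K : {set G} | [&& K \subset A, #|K| == t & clique K]].

Definition kin t A : nat := #|kset t A|.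

Lemma kinT t : kin t setT = num_cliques t G.
Proof. by apply: eq_card => K; rewrite !inE subsetT. Qed.

Lemma kinS t A B : A \subset B -> kin t A <= kin t B.
Proof.
move=> h; apply/subset_leq_card/subsetP => K; rewrite !inE => /and3P[h1 -> ->].
by rewrite (subset_trans h1 h).
Qed.

Lemma cliqueP K : reflect {in K &, forall x y, x != y -> edge x y} (clique K).
Proof.
apply: (iffP 'forall_in_'forall_in_implyP) => h x y *; first exact: h.
by apply: h.
Qed.

Lemma clique_sub K K' : K' \subset K -> clique K -> clique K'.
Proof.
move=> /subsetP h /cliqueP hK; apply/cliqueP => x y hx hy.
by apply: hK; apply: h.
Qed.

Lemma cliqueU1 v K : K \subset nbh v -> clique (v |: K) = clique K.
Proof.
move=> /subsetP h; apply/idP/idP => [|/cliqueP hK].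
  by apply: clique_sub; apply: subsetUr.
apply/cliqueP => x y /setU1P[->|hx] /setU1P[->|hy].
- by rewrite eqxx.
- by move=> _; have := h _ hy; rewrite inE.
- by move=> _; have := h _ hx; rewrite inE edge_sym.
- exact: hK.
Qed.

Lemma nbh_irr v : v \in nbh v = false.
Proof. by rewrite inE edge_irrefl. Qed.

Lemma kin_link t A v : v \in A ->
  #|[set K in kset t.+1 A | v \in K]| = kin t (A :&: nbh v).
Proof.
move=> vA; rewrite /kin -[RHS](card_in_imset (f := fun K => v |: K)).
  apply: eq_card => K; apply/setIdP/imsetP.
    rewrite inE => -[/and3P[KA /eqP cK hK] vK].
    exists (K :\ v); last by rewrite setD1K.
    rewrite !inE subsetI (subset_trans (subD1set _ _) KA) /=.
    rewrite (clique_sub (subD1set _ _) hK) andbT.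
    move: cK; rewrite (cardsD1 v) vK add1n => -[->]; rewrite eqxx andbT.
    apply/subsetP => x /setD1P[xv xK]; rewrite inE.
    by move/cliqueP: hK => -> //; rewrite eq_sym.
  case=> K'; rewrite !inE subsetI => /and3P[/andP[h1 h2] /eqP h3 h4] ->.
  rewrite setU11 cliqueU1 // h4 subUset sub1set vA h1 cardsU1 h3.
  suff -> : v \notin K' by rewrite eqxx.
  by apply/negP => /(subsetP h2); rewrite nbh_irr.
move=> K1 K2; rewrite !inE !subsetI.
move=> /and3P[/andP[_ h1] _ _] /and3P[/andP[_ h2] _ _] e.
have hK K : K \subset nbh v -> (v |: K) :\ v = K.
  by move=> h; rewrite setU1K //; apply/negP => /(subsetP h); rewrite nbh_irr.
by rewrite -(hK _ h1) -(hK _ h2) e.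
Qed.

Lemma kin_del t A v : v \in A ->
  kin t.+1 A = kin t.+1 (A :\ v) + kin t (A :&: nbh v).
Proof.
move=> vA; rewrite -(kin_link t vA) addnC /kin.
rewrite -(cardsID [set K : {set G} | v \in K] (kset t.+1 A)); congr (_ + _).
  by apply: eq_card => K; rewrite !inE.
apply: eq_card => K; rewrite !inE subsetD1; case: (v \in K) => //=.
by rewrite andbF.
by rewrite andbT.
Qed.

Lemma kin_handshake t A :
  \sum_(v in A) kin t (A :&: nbh v) = t.+1 * kin t.+1 A.
Proof.
transitivity (\sum_(v in A) \sum_(K in kset t.+1 A) (v \in K : nat)).
  apply: eq_bigr => v vA; rewrite -(kin_link t vA) -sum1dep_card big_mkcondr /=.
  by apply: eq_bigr => K _; case: (v \in K).
rewrite exchange_big /= /kin mulnC -sum_nat_const.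
apply: eq_bigr => K; rewrite inE => /and3P[/subsetP KA /eqP <- _].
rewrite -sum1_card [RHS](bigID (mem A)) /= [X in _ = _ + X]big1 ?addn0; last first.
  by move=> x /andP[/KA ->].
rewrite [RHS]big_mkcond [LHS]big_mkcond /=; apply: eq_bigr => x _.
by case: (x \in A); case: (x \in K).
Qed.

Lemma kin0 A : kin 0 A = 1.
Proof.
rewrite /kin -(cards1 (set0 : {set G})); apply: eq_card => K; rewrite !inE cards_eq0.
case: eqP => [->|]; rewrite ?andbF // sub0set /=.
by apply/cliqueP => x y; rewrite inE.
Qed.

Lemma kin_set0 t : kin t.+1 set0 = 0.
Proof.
apply: eq_card0 => K; rewrite !inE subset0.
by case: eqP => // ->; rewrite cards0.
Qed.

Lemma kin_geq1 t A K : K \subset A -> #|K| = t -> clique K -> 0 < kin t A.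
Proof.
move=> h1 h2 h3; apply/card_gt0P; exists K.
by rewrite !inE h1 h2 eqxx h3.
Qed.

(* If all degrees in [A] were larger, fewer than [#|A|] vertices would be
   non-adjacent to some vertex of a given clique with at most [r] elements, so
   the clique could be extended. *)
Lemma exists_low_degree r A m : #|A| = m.+1 -> kin r.+1 A = 0 ->
  exists2 v, v \in A & #|A :&: nbh v| <= tdeg r m.
Proof.
move=> cA free; apply/exists_inP/contraT.
move=> /exists_inPn hd; exfalso.
have hnb v : v \in A -> #|A :\: nbh v| <= m %/ r.
  move=> vA; have := hd v vA; have := cardsID (nbh v) A; rewrite cA /tdeg -ltnNge.
  have := leq_div m r; lia.
suff H j : j <= r.+1 -> exists K, [/\ K \subset A, #|K| = j & clique K].
  by have [K [h1 h2 h3]] := H r.+1 (leqnn _); have := kin_geq1 h1 h2 h3; rewrite free.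
elim: j => [|j IH] hj.
  by exists set0; rewrite sub0set cards0; split=> //; apply/cliqueP => x y; rewrite inE.
have [K [h1 h2 h3]] := IH (ltnW hj).
have : #|\bigcup_(v in K) (A :\: nbh v)| <= m.
  apply: (@leq_trans (\sum_(v in K) #|A :\: nbh v|)).
    elim/big_ind2: _ => [|x1 x2 y1 y2 a b|//]; first by rewrite cards0.
    by apply: leq_trans (leq_card_setU _ _) (leq_add a b).
  apply: (@leq_trans (\sum_(v in K) m %/ r)).
    by apply: leq_sum => v vK; apply/hnb/(subsetP h1).
  rewrite sum_nat_const h2; apply: leq_trans (leq_divM m r).
  by rewrite mulnC leq_mul.
move=> hc; have : ~~ (A \subset \bigcup_(v in K) (A :\: nbh v)).
  by apply/negP => /subset_leq_card; rewrite cA leqNgt ltnS hc.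
case/subsetPn => x xA hx; exists (x |: K).
have hK : K \subset nbh x.
  apply/subsetP => v vK; rewrite inE edge_sym; apply/contraT => he.
  by case/bigcupP: hx; exists v => //; rewrite !inE he xA.
rewrite subUset sub1set xA h1 cliqueU1 // cardsU1 h2; split=> //.
by rewrite (_ : x \notin K) //; apply/negP => /(subsetP hK); rewrite nbh_irr.
Qed.

Lemma kin_free_link r A v : v \in A -> kin r.+1 A = 0 -> kin r (A :&: nbh v) = 0.
Proof. by move=> vA; rewrite (kin_del _ vA); lia. Qed.

(** Cliques split into those avoiding and those containing a vertex of low degree. The first are
    bounded by induction on the number of vertices, the second by induction on [t] in its link,
    which has a smaller clique number; the two bounds add up to the recursion [tclS]. *)
Theorem zykov t r A : kin r.+1 A = 0 -> kin t A <= tcl t r #|A|.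
Proof.
elim: t r A => [|t IHt] r A free; first by rewrite kin0.
move: {2}#|A| (leqnn #|A|) => m; elim: m A free => [|m IHm] A free.
  by rewrite leqn0 cards_eq0 => /eqP->; rewrite kin_set0.
case cA: #|A| => [|k]; first by move/cards0_eq: cA => ->; rewrite kin_set0.
rewrite ltnS => km.
have [v vA hv] := exists_low_degree cA free.
rewrite (kin_del _ vA) tclS leq_add //.
  have ck : #|A :\ v| = k by move: cA; rewrite (cardsD1 v) vA => -[].
  rewrite -ck IHm ?ck //; apply/eqP; rewrite -leqn0 -free kinS //; exact: subD1set.
case: r free {IHm} hv => [|r] free hv.
  have := kin_free_link vA free.
  by rewrite kin0.
apply: leq_trans (tcl_mono t r hv); apply: IHt; exact: kin_free_link free.
Qed.

Lemma kin_degree_leq t r A v D : kin r.+2 A = 0 -> v \in A ->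
  #|A :&: nbh v| <= D -> kin t (A :&: nbh v) <= tcl t r D.
Proof.
move=> free vA hD; apply: leq_trans (tcl_mono t r hD); apply: zykov.
exact: kin_free_link free.
Qed.

Lemma kin_delete_low t r D A J : kin r.+2 A = 0 -> J \subset A ->
  (forall v, v \in J -> #|A :&: nbh v| <= D) ->
  kin t.+1 A <= tcl t.+1 r.+1 (#|A| - #|J|) + #|J| * tcl t r D.
Proof.
move cJ: #|J| => j; rewrite -cJ.
elim: j A J cJ => [|j IH] A J cJ free JA hJ.
  by rewrite cJ subn0 addn0; apply: zykov.
have /card_gt0P[v vJ] : 0 < #|J| by rewrite cJ.
have vA := subsetP JA v vJ.
rewrite (kin_del _ vA).
have := IH (A :\ v) (J :\ v).
have e1 : #|A| = (#|A :\ v|).+1 by rewrite (cardsD1 v A) vA.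
have e2 : #|J| = (#|J :\ v|).+1 by rewrite (cardsD1 v J) vJ.
have h := kin_degree_leq t free vA (hJ v vJ).
have fr : kin r.+2 (A :\ v) = 0.
  by apply/eqP; rewrite -leqn0 -free kinS //; exact: subD1set.
move=> /(_ _ fr (setSD _ JA)).
rewrite e1 e2 subSS mulSn => H.
have : kin t.+1 (A :\ v) <= tcl t.+1 r.+1 (#|A :\ v| - #|J :\ v|) + #|J :\ v| * tcl t r D.
  apply: H; first by move: cJ; rewrite e2 => -[].
  move=> x /setD1P[_ xJ]; apply: leq_trans (hJ x xJ); apply: subset_leq_card.
  by apply: setSI; exact: subD1set.
lia.
Qed.

End Counting.

Lemma clique_freeP r (G : sgraph) : clique_free r G -> kin r [set: G] = 0.
Proof.
move=> h; apply: eq_card0 => K; rewrite !inE subsetT /=.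
by apply/negP => /andP[/eqP h1 h2]; exact: (h K).
Qed.

(** * Lower bounds for the clique counts of Turan and extremal graphs *)

Section Embeddings.
Variables (G H : sgraph) (f : G -> H).
Hypotheses (f_inj : injective f) (f_edge : forall x y, edge x y -> edge (f x) (f y)).

Lemma num_cliques_embed t (B : {set H}) : (forall x, f x \in B) ->
  num_cliques t G <= kin t B.
Proof.
move=> hB; rewrite /num_cliques -(card_imset _ (imset_inj f_inj)).
apply/subset_leq_card/subsetP => _ /imsetP[K + ->].
rewrite !inE card_imset // => /andP[-> /cliqueP hK] /=; apply/andP; split.
  by apply/subsetP => _ /imsetP[x _ ->].
apply/cliqueP => _ _ /imsetP[x xK ->] /imsetP[y yK ->] hxy.
by apply/f_edge/hK => //; apply: contraNneq hxy => ->.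
Qed.

End Embeddings.

Lemma num_cliques_vertex t (G1 G2 H : sgraph) (x : H) (f : G1 -> H) (g : G2 -> H) :
  injective f -> (forall u v, edge u v -> edge (f u) (f v)) ->
  (forall u, f u != x) ->
  injective g -> (forall u v, edge u v -> edge (g u) (g v)) ->
  (forall u, edge x (g u)) ->
  num_cliques t.+1 G1 + num_cliques t G2 <= num_cliques t.+1 H.
Proof.
move=> f_inj f_edge fx g_inj g_edge gx.
rewrite -[leqRHS]kinT (kin_del t (in_setT x)); apply: leq_add.
  by apply: (num_cliques_embed f_inj) => // u; rewrite !inE fx.
by apply: (num_cliques_embed g_inj) => // u; rewrite !inE gx.
Qed.

Section TuranLink.
Variables (r m : nat).
Hypothesis r0 : 0 < r.

(** The j-th vertex of [turan r m] outside the part of the new vertex [m]: quotient and remainder of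
    [j] modulo [r.-1] become quotient and remainder modulo [r], with the remainder [m %% r] left
    out. *)
Let skip (j : nat) : nat :=
  j %/ r.-1 * r + (j %% r.-1 + (m %% r <= j %% r.-1)).

Lemma turan_link_pos j : j < tdeg r m -> 0 < r.-1.
Proof. by rewrite /tdeg; case: r r0 => [|[|]] //= _; rewrite divn1 subnn. Qed.

Lemma turan_link_lt j : j < tdeg r m -> skip j < m.+1.
Proof.
move=> hj; have hr := turan_link_pos hj; move: hj.
rewrite /tdeg /skip; have := divn_eq m r; have := divn_eq j r.-1.
have := ltn_pmod m r0; have := ltn_pmod j hr.
set a := j %/ _; set b := j %% _; set q := m %/ r; set c := m %% r.
move=> hb hc hj hm hjd.
have e : q * r = q * r.-1 + q by rewrite -{1}(prednK r0) mulnS addnC.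
have h : a * r.-1 + b < q * r.-1 + c by lia.
case: (ltngtP a q) => haq.
- have : a.+1 * r <= q * r by rewrite leq_mul2r haq orbT.
  by rewrite mulSn; case: (c <= b); lia.
- have : q.+1 * r.-1 <= a * r.-1 by rewrite leq_mul2r haq orbT.
  by rewrite mulSn; lia.
- by rewrite haq in h *; rewrite (_ : c <= b = false) ?addn0; lia.
Qed.

Lemma turan_link_mod j : 0 < r.-1 ->
  skip j %% r = j %% r.-1 + (m %% r <= j %% r.-1).
Proof.
move=> hr; have := ltn_pmod j hr => h.
by rewrite /skip modnMDl modn_small //; case: (m %% r <= _); lia.
Qed.

Lemma turan_link_div j : 0 < r.-1 -> skip j %/ r = j %/ r.-1.
Proof.
move=> hr; have := ltn_pmod j hr => h.
rewrite /skip divnMDl // [X in _ + X]divn_small ?addn0 //.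
by case: (m %% r <= _); lia.
Qed.

Lemma tcl_turan_step t :
  num_cliques t.+1 (turan r m) + num_cliques t (turan r.-1 (tdeg r m)) <=
  num_cliques t.+1 (turan r m.+1).
Proof.
pose f (i : turan r m) : turan r m.+1 := widen_ord (leqnSn m) i.
pose g (j : turan r.-1 (tdeg r m)) : turan r m.+1 := Ordinal (turan_link_lt (ltn_ord j)).
have r1 : forall j : turan r.-1 (tdeg r m), 0 < r.-1.
  by move=> j; apply: turan_link_pos (ltn_ord j).
apply: (@num_cliques_vertex t _ _ (turan r m.+1) (ord_max : (ordinal m.+1)) f g).
- by move=> i j /(congr1 val) /= e; apply: val_inj.
- by [].
- by move=> i; rewrite -val_eqE /= neq_ltn ltn_ord.
- move=> i j /(congr1 val) /= e; apply: val_inj => /=.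
  have h := r1 i.
  have ed : i %/ r.-1 = j %/ r.-1 by rewrite -!turan_link_div // e.
  have em : skip i %% r = skip j %% r by rewrite e.
  move: em; rewrite !turan_link_mod // => em.
  rewrite (divn_eq i r.-1) (divn_eq j r.-1) ed; congr (_ + _).
  by move: em; do 2 case: leqP => ?; lia.
- move=> i j; have h := r1 i; rewrite /edge /= /turan_rel /= !turan_link_mod //.
  by do 2 case: leqP => ?; lia.
- move=> i; have h := r1 i; rewrite /edge /= /turan_rel /= turan_link_mod //.
  by case: leqP => ?; lia.
Qed.

End TuranLink.

Lemma num_cliques0 (G : sgraph) : num_cliques 0 G = 1.
Proof. by rewrite -kinT kin0. Qed.

Lemma tcl_turan t r m : 0 < r -> tcl t r m <= num_cliques t (turan r m).
Proof.
elim: t r m => [|t IHt] r m r0; first by rewrite num_cliques0.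
elim: m => [|m IHm]; first by rewrite tclS0.
rewrite tclS; apply: leq_trans (tcl_turan_step m r0 t); apply: leq_add => //.
case: r r0 {IHm} => [|[|r]] // _; last exact: IHt.
by rewrite /tdeg divn1 subnn; case: t {IHt} => [|t]; rewrite ?num_cliques0 ?tclS0.
Qed.

Lemma Gstar_num_cliques t r n (l : int) (H : sgraph) : 1 < r -> Gstar n r l H ->
  num_cliques t.+1 (turan r n.-1) + num_cliques t (turan r.-1 `|(l + 1)%R|) <=
  num_cliques t.+1 H.
Proof.
move=> r1 [_ _ [x [f [[[f' fK f'K] fe] [g [[g' gK g'K] ge]] _]]]].
apply: (@num_cliques_vertex t _ _ _ x (fun i => val (f' i)) (fun j => val (g' j))).
- by apply: inj_comp val_inj (can_inj f'K).
- by move=> u v huv; rewrite -[edge _ _]/(edge (f' u) (f' v)) -fe !f'K.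
- by move=> u; have := valP (f' u); rewrite !inE.
- by apply: inj_comp val_inj (can_inj g'K).
- by move=> u v huv; rewrite -[edge _ _]/(edge (g' u) (g' v)) -ge !g'K.
- by move=> u; have := valP (g' u); rewrite inE.
Qed.

(** * Deleting vertices of low degree *)

Lemma big_nat_pred n j (F : nat -> nat) : j <= n ->
  \sum_(n - j <= x < n.-1) F x = \sum_(y < j.-1) F (n - j + y).
Proof.
move=> jn; rewrite -{1}(add0n (n - j)) big_addn big_mkord.
rewrite (_ : n.-1 - (n - j) = j.-1); last by lia.
by apply: eq_bigr => y _; rewrite addnC.
Qed.

(* The case t = 2 of the comparison between deleting [j] vertices of degree less
   than [i + q] and the extremal graph. *)
Definition deletable (r n q i : nat) :=
  exists2 j, 0 < j <= i &
  j * (i + q).-1 <= \sum_(n - j <= x < n.-1) tdeg r x + q.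

Lemma deletable_le r r' n q i : 0 < r <= r' -> deletable r n q i -> deletable r' n q i.
Proof.
move=> hr [j hj h]; exists j => //; apply: leq_trans h _; rewrite leq_add2r.
by apply: leq_sum => x _; exact: tdeg_le.
Qed.

(** For i >= 6 the choice j = 6 works: as i <= (n-q)/2, the left side is at most 3n + 3q and the
    right side is about 10n/3 + q, up to constants. The margin n/3 - 2q explains the slope 6 in
    [6 * q + 20]. Smaller i take j = i. *)
Lemma deletable3 n q i : 0 < i -> 2 * i + q <= n -> 6 * q + 20 <= n ->
  deletable 3 n q i.
Proof.
move=> i0 hi hn.
have [i1|i1] := leqP i 1; first by exists 1; rewrite ?i0 // big_nat_pred ?big_ord0; lia.
have [i2|i2] := leqP i 2.
  by exists 2; rewrite ?i1 // big_nat_pred /= ?big_ord_recr ?big_ord0 /= /tdeg; lia.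
have [i3|i3] := leqP i 3.
  by exists 3; rewrite ?i2 // big_nat_pred /= ?big_ord_recr ?big_ord0 /= /tdeg; lia.
have [i4|i4] := leqP i 4.
  by exists 4; rewrite ?i3 // big_nat_pred /= ?big_ord_recr ?big_ord0 /= /tdeg; lia.
have [i5|i5] := leqP i 5.
  by exists 5; rewrite ?i4 // big_nat_pred /= ?big_ord_recr ?big_ord0 /= /tdeg; lia.
by exists 6; rewrite ?i5 // big_nat_pred /= ?big_ord_recr ?big_ord0 /= /tdeg; lia.
Qed.

(** A fixed j leaves a linear margin when (j-1)(1-1/r) > j/2, that is from j = 5 on for r = 3, from
    j = 4 on for r = 4, and from j = 3 on for r = 5 and r = 6. This guides the last witness in each
    of these case distinctions. *)
Lemma deletable4 n q i : 0 < i -> 2 * i + q <= n -> q = 0 \/ 5 * q + 6 <= n ->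
  deletable 4 n q i.
Proof.
move=> i0 hi hn.
have [i1|i1] := leqP i 1; first by exists 1; rewrite ?i0 // big_nat_pred ?big_ord0; lia.
have [i2|i2] := leqP i 2.
  by exists 2; rewrite ?i1 // big_nat_pred /= ?big_ord_recr ?big_ord0 /= /tdeg; lia.
have [i3|i3] := leqP i 3.
  by exists 3; rewrite ?i2 // big_nat_pred /= ?big_ord_recr ?big_ord0 /= /tdeg; lia.
by exists 4; rewrite ?i3 // big_nat_pred /= ?big_ord_recr ?big_ord0 /= /tdeg; lia.
Qed.

Lemma deletable5 n q i : 0 < i -> 2 * i + q <= n -> q <= 1 \/ 3 * q + 4 <= n ->
  deletable 5 n q i.
Proof.
move=> i0 hi hn.
have [i1|i1] := leqP i 1; first by exists 1; rewrite ?i0 // big_nat_pred ?big_ord0; lia.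
have [i2|i2] := leqP i 2.
  by exists 2; rewrite ?i1 // big_nat_pred /= ?big_ord_recr ?big_ord0 /= /tdeg; lia.
have [i3|i3] := leqP i 3.
  by exists 3; rewrite ?i2 // big_nat_pred /= ?big_ord_recr ?big_ord0 /= /tdeg; lia.
by exists 4; rewrite ?i3 // big_nat_pred /= ?big_ord_recr ?big_ord0 /= /tdeg; lia.
Qed.

Lemma deletable6 n q i : 0 < i -> 2 * i + q <= n -> q <= 2 -> deletable 6 n q i.
Proof.
move=> i0 hi hn.
have [i1|i1] := leqP i 1; first by exists 1; rewrite ?i0 // big_nat_pred ?big_ord0; lia.
have [i2|i2] := leqP i 2.
  by exists 2; rewrite ?i1 // big_nat_pred /= ?big_ord_recr ?big_ord0 /= /tdeg; lia.
by exists 3; rewrite ?i2 // big_nat_pred /= ?big_ord_recr ?big_ord0 /= /tdeg; lia.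
Qed.

Lemma leq_mul_tdeg r x : r.-1 * x <= r * tdeg r x.
Proof.
rewrite /tdeg mulnBr; have := leq_divM x r; case: r => [|r]; rewrite /= ?mulnS; lia.
Qed.

Lemma sum_arith a p : 2 * \sum_(y < p) (a + y) = p * (2 * a + p.-1).
Proof.
elim: p => [|p IH]; first by rewrite big_ord0.
rewrite big_ord_recr /= mulnDr IH; case: p {IH} => [|p] /=; nia.
Qed.

(** Here j = i. Since i(i+q-1) = (i-1)(i+q) + q, the summand [q] cancels; bounding [tdeg r x] below
    by (r-1)x/r turns the sum into an arithmetic series with the same factor i-1, and what remains
    is linear in i. *)
Lemma deletable8 r n q i : 4 <= r -> 0 < i -> 2 * i + q <= n ->
  (q + 4) * (r - 4) + 4 * (q + 3) <= n * (r - 4) -> deletable r n q i.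
Proof.
move=> r4 i0 hi hn; exists i; rewrite ?i0 ?leqnn // big_nat_pred; last by lia.
have h : r.-1 * (i.-1 * (2 * (n - i) + i.-2)) <=
         2 * (r * \sum_(y < i.-1) tdeg r (n - i + y)).
  rewrite -sum_arith mulnCA leq_mul2l /= !big_distrr /=.
  by apply: leq_sum => y _; exact: leq_mul_tdeg.
suff : i.-1 * (i + q) <= \sum_(y < i.-1) tdeg r (n - i + y) by case: i i0 {hi h} => //= i _; nia.
have [s es] : exists s, n = 2 * i + q + s by exists (n - (2 * i + q)); lia.
have [u eu] : exists u, r = u + 4 by exists (r - 4); lia.
have : 2 * r * (i + q) * i.-1 <= r.-1 * (2 * (n - i) + i.-2) * i.-1.
  case: (leqP i 1) => i1; first by rewrite (_ : i.-1 = 0) ?muln0 //; lia.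
  rewrite leq_mul2r; apply/orP; right; move: hn; rewrite es eu addnK.
  rewrite (_ : (u + 4).-1 = u + 3); last by lia.
  rewrite (_ : 2 * (2 * i + q + s - i) + i.-2 = 3 * i + 2 * q + 2 * s - 2); last by lia.
  have [v ev] : exists v, i = v + 2 by exists (i - 2); lia.
  by rewrite ev (_ : 3 * (v + 2) + 2 * q + 2 * s - 2 = 3 * v + 4 + 2 * q + 2 * s); lia.
move: (\sum_(y < i.-1) _) h => S h h'.
have : 2 * r * ((i + q) * i.-1) <= 2 * r * S by lia.
by rewrite leq_pmul2l; lia.
Qed.

(* As [deletable] for [q = 1], when a vertex of degree [i.+1 + e] is deleted before
   [j] vertices of remaining degree at most [i.+1]. *)
Definition deletable_after_min (r n i e : nat) :=
  exists2 j, 0 < j <= i &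
  j.+1 * i.+1 + e <= \sum_(n - j.+1 <= x < n.-1) tdeg r x + 1.

Lemma deletable_after_min_le r r' n i e : 0 < r <= r' ->
  deletable_after_min r n i e -> deletable_after_min r' n i e.
Proof.
move=> hr [j hj h]; exists j => //; apply: leq_trans h _; rewrite leq_add2r.
by apply: leq_sum => x _; exact: tdeg_le.
Qed.

Lemma deletable_after_min3 n i e : 0 < i -> 2 * i + 3 <= n -> 2 * (i + e).+1 <= n ->
  e <= 1 -> 26 <= n -> deletable_after_min 3 n i e.
Proof.
move=> i0 hi he e1 hn.
have [i1|i1] := leqP i 1.
  by exists 1; rewrite ?i0 // big_nat_pred /= ?big_ord_recr ?big_ord0 /= /tdeg; lia.
have [i2|i2] := leqP i 2.
  by exists 2; rewrite ?i1 // big_nat_pred /= ?big_ord_recr ?big_ord0 /= /tdeg; lia.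
have [i3|i3] := leqP i 3.
  by exists 3; rewrite ?i2 // big_nat_pred /= ?big_ord_recr ?big_ord0 /= /tdeg; lia.
have [i4|i4] := leqP i 4.
  by exists 4; rewrite ?i3 // big_nat_pred /= ?big_ord_recr ?big_ord0 /= /tdeg; lia.
have [i5|i5] := leqP i 5.
  by exists 5; rewrite ?i4 // big_nat_pred /= ?big_ord_recr ?big_ord0 /= /tdeg; lia.
by exists 6; rewrite ?i5 // big_nat_pred /= ?big_ord_recr ?big_ord0 /= /tdeg; lia.
Qed.

Lemma deletable_after_min4 n i e : 0 < i -> 2 * i + 3 <= n -> 2 * (i + e).+1 <= n ->
  e <= 1 -> 11 <= n -> deletable_after_min 4 n i e.
Proof.
move=> i0 hi he e1 hn.
have [i1|i1] := leqP i 1.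
  by exists 1; rewrite ?i0 // big_nat_pred /= ?big_ord_recr ?big_ord0 /= /tdeg; lia.
have [i2|i2] := leqP i 2.
  by exists 2; rewrite ?i1 // big_nat_pred /= ?big_ord_recr ?big_ord0 /= /tdeg; lia.
by exists 3; rewrite ?i2 // big_nat_pred /= ?big_ord_recr ?big_ord0 /= /tdeg; lia.
Qed.

Lemma deletable_after_min5 n i e : 0 < i -> 2 * i + 3 <= n -> 2 * (i + e).+1 <= n ->
  e <= 1 -> 6 <= n -> deletable_after_min 5 n i e.
Proof.
move=> i0 hi he e1 hn.
have [i1|i1] := leqP i 1.
  by exists 1; rewrite ?i0 // big_nat_pred /= ?big_ord_recr ?big_ord0 /= /tdeg; lia.
have [i2|i2] := leqP i 2.
  by exists 2; rewrite ?i1 // big_nat_pred /= ?big_ord_recr ?big_ord0 /= /tdeg; lia.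
by exists 3; rewrite ?i2 // big_nat_pred /= ?big_ord_recr ?big_ord0 /= /tdeg; lia.
Qed.

Lemma subset_of_card (T : finType) (A : {set T}) j : j <= #|A| ->
  exists2 J : {set T}, J \subset A & #|J| = j.
Proof.
move=> hj; exists [set x in take j (enum A)].
  by apply/subsetP => x; rewrite inE => /mem_take; rewrite mem_enum.
rewrite cardsE; have /card_uniqP -> : uniq (take j (enum A)).
  by apply/take_uniq/enum_uniq.
by rewrite size_takel // -cardE.
Qed.

(** The right-hand side bounds from below the cliques of [Gstar] with l + 1 = q: those avoiding the
    added vertex and those containing it. *)
Definition few_cliques t r q (G : sgraph) :=
  num_cliques t.+2 G <= tcl t.+2 r #|G|.-1 + tcl t.+1 r.-1 q.

Lemma low_degree_few_cliques t r q i (G : sgraph) :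
  0 < r -> clique_free r.+1 G -> deletable r #|G| q i -> i <= #|G| ->
  i <= #|[set x : G | #|nbh x| < i + q]| -> few_cliques t r q G.
Proof.
case: r => // r _ free [j /andP[j0 ji] hsum] iG hi; rewrite /few_cliques.
have [J JS cJ] := subset_of_card (leq_trans ji hi).
have := @kin_delete_low G t.+1 r (i + q).-1 setT J (clique_freeP free) (subsetT J).
rewrite kinT cJ cardsT => H; apply: leq_trans (H _) _ => {H}.
  by move=> v /(subsetP JS); rewrite inE setTI; case: (i + q).
rewrite (@tcl_range t.+1 r.+1 (#|G| - j) #|G|.-1); last by lia.
rewrite -addnA leq_add2l.
have := @tcl_jensen t r r.+1 (#|G| - j) #|G|.-1 q (i + q).-1 0.
rewrite (_ : #|G|.-1 - (#|G| - j) = j.-1); last by lia.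
rewrite !addn0 -mulSnr !prednK //.
by apply=> //; lia.
Qed.

(** The vertex [u] is deleted first; its degree may exceed the bound [i.+1] for the others by [e],
    which makes it the point [D + e] of [tcl_jensen]. *)
Lemma low_degree_after_min_few_cliques t r i e (G : sgraph) (u : G) :
  1 < r -> clique_free r.+1 G -> deletable_after_min r #|G| i e -> e <= 1 ->
  i < #|G| -> #|nbh u| <= i.+1 + e ->
  i <= #|[set x in ~: [set u] | #|nbh x :\ u| <= i.+1]| -> few_cliques t r 1 G.
Proof.
case: r => // r r1 free [j /andP[j0 ji] hsum] e1 iG hu hi; rewrite /few_cliques.
have [J JS cJ] := subset_of_card (leq_trans ji hi).
have fr := clique_freeP free.
rewrite -kinT (kin_del _ (in_setT u)) setTI.
have h1 : kin t.+1 (nbh u) <= tcl t.+1 r (i.+1 + e).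
  rewrite -(setTI (nbh u)); apply: kin_degree_leq => //.
  by rewrite setTI.
have JA : J \subset setT :\ u.
  apply: subset_trans JS _; apply/subsetP => x; rewrite !inE.
  by case/andP => -> _.
have fr' : kin r.+2 (setT :\ u) = 0.
  by apply/eqP; rewrite -leqn0 -fr kinS.
have := @kin_delete_low G t.+1 r i.+1 (setT :\ u) J fr' JA.
have -> : #|setT :\ u| = #|G|.-1 by rewrite -cardsT (cardsD1 u setT) inE.
rewrite cJ => H; apply: leq_trans (leq_add (H _) h1) _ => {H}.
  move=> v /(subsetP JS); rewrite !inE => /andP[_]; apply: leq_trans.
  by apply: subset_leq_card; apply/subsetP => x; rewrite !inE andbT.
rewrite (@tcl_range t.+1 r.+1 (#|G| - j.+1) #|G|.-1); last by lia.
rewrite (_ : #|G|.-1 - j = #|G| - j.+1); last by lia.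
rewrite -!addnA leq_add2l.
have := @tcl_jensen t r r.+1 (#|G| - j.+1) #|G|.-1 1 i.+1 e.
rewrite (_ : #|G|.-1 - (#|G| - j.+1) = j); last by lia.
by apply=> //; lia.
Qed.

(** * Posa's theorem for cycles through a path *)

Section CycleLists.
Variables (T : eqType) (e : rel T).
Hypothesis e_sym : symmetric e.
Implicit Types (x y z : T) (p s : seq T).

Lemma cycle_cat x p y s : cycle e ((x :: p) ++ y :: s) =
  [&& path e x p, e (last x p) y, path e y s & e (last y s) x].
Proof. by rewrite /= rcons_cat cat_path /= rcons_path !andbA. Qed.

Lemma rev_last x p : rev (x :: p) = last x p :: rev (belast x p).
Proof. by rewrite lastI rev_rcons. Qed.

Lemma last_rev_belast x p : last (last x p) (rev (belast x p)) = x.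
Proof. by case: p => //= y p; rewrite rev_cons last_rcons. Qed.

Lemma rev_path_sym x p : path e (last x p) (rev (belast x p)) = path e x p.
Proof. by rewrite rev_path; apply: eq_path => y z; rewrite e_sym. Qed.

(* The two ends of the path [x :: p ++ y :: s] are joined crosswise to the
   two ends of its edge from [last x p] to [y]. *)
Lemma crossing_cycle x p y s : path e x p -> path e y s -> e x y ->
  e (last x p) (last y s) ->
  cycle e (rev (x :: p) ++ y :: s) /\ cycle e ((x :: p) ++ rev (y :: s)).
Proof.
move=> h1 h2 h3 h4; rewrite !rev_last !cycle_cat !last_rev_belast !rev_path_sym.
by rewrite h1 h2 h3 h4 /= e_sym h4 e_sym h3.
Qed.

Lemma cycle_rev_sym p : cycle e (rev p) = cycle e p.
Proof. by rewrite rev_cycle; apply: eq_cycle => y z; rewrite e_sym. Qed.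

Lemma path_first_failure (e' : rel T) x p : path e' x p -> ~~ path e x p ->
  exists p1 y p2, [/\ p = p1 ++ y :: p2, e' (last x p1) y & ~~ e (last x p1) y].
Proof.
elim: p x => //= y p IH x /andP[h1 h2]; rewrite negb_and => /orP[h|h].
  by exists [::], y, p.
have [p1 [z [p2 [-> h3 h4]]]] := IH _ h2 h.
by exists (y :: p1), z, p2.
Qed.

(** A path without repetition never steps back to its first vertex, and a step from the first vertex
    to the last would be the whole path. *)
Lemma sorted_but_ends (e' : rel T) x p : uniq (x :: p) -> 1 < size p ->
  (forall y z, e' y z -> [|| e y z, z == x | (y == x) && (z == last x p)]) ->
  path e' x p -> path e x p.
Proof.
move=> hu hs he /(pathP x) h; apply/(pathP x) => i hi.
have hi' : i < size (x :: p) by rewrite /= ltnS ltnW.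
have {h} := he _ _ (h i hi); case/or3P => //.
  by rewrite -[nth x p i]/(nth x (x :: p) i.+1) [_ == x](nth_uniq x (i := i.+1) (j := 0)).
case/andP; rewrite [_ == x](nth_uniq x (j := 0)) // => /eqP i0.
rewrite i0 (last_nth x) -[nth x p 0]/(nth x (x :: p) 1) nth_uniq //; last first.
  exact: ltnW.
by move/eqP => hp; rewrite -hp in hs.
Qed.

End CycleLists.

(** A cycle containing the path [s] can be rotated, and reversed if necessary, so that its list
    begins with [s]. *)
Definition hamiltonian_through (T : finType) (e : rel T) (s : seq T) : Prop :=
  exists p, [/\ uniq (s ++ p), cycle e (s ++ p) & forall v, v \in s ++ p].

Lemma hamiltonian_through_infix (T : finType) (e : rel T) (a s b : seq T) :
  uniq (a ++ s ++ b) -> cycle e (a ++ s ++ b) -> (forall v, v \in a ++ s ++ b) ->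
  hamiltonian_through e s.
Proof.
move=> h1 h2 h3; exists (b ++ a).
have er : s ++ b ++ a = rot (size a) (a ++ s ++ b) by rewrite rot_size_cat catA.
by rewrite er rot_uniq rot_cycle; split=> // v; rewrite mem_rot.
Qed.

Lemma hamiltonian_through_rev (T : finType) (e : rel T) (s : seq T) :
  symmetric e -> hamiltonian_through e (rev s) -> hamiltonian_through e s.
Proof.
move=> e_sym [p [h1 h2 h3]]; apply: (@hamiltonian_through_infix _ _ (rev p) s [::]);
  rewrite cats0 -(revK s) -rev_cat.
- by rewrite rev_uniq.
- by rewrite cycle_rev_sym.
- by move=> v; rewrite mem_rev.
Qed.

Section Posa.
Variable T : finType.
Implicit Types (e : rel T) (s : seq T).

Definition deg e x := #|[set y | e x y]|.

(* Posa's condition for paths with [q] vertices, that is [q.-1] edges. *)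
Definition posa_rel q e := forall i, 0 < i -> 2 * i + q <= #|T| ->
  #|[set x | deg e x < i + q]| < i.

(* With [a], [z] the ends of the Hamiltonian path, a crossing edge outside [s]
   closes it to a cycle; otherwise the predecessors of the neighbours of [a] are
   non-neighbours of [z], so by maximality their degree is at most [deg e a],
   against Posa's condition. *)
Lemma crossing_contra e s p3 p1 a Q' (z := last a Q') :
  symmetric e -> irreflexive e ->
  (size s).+2 <= #|T| -> posa_rel (size s) e -> ~ hamiltonian_through e s ->
  0 < size s ->
  p3 ++ s ++ p1 = a :: Q' -> uniq (a :: Q') -> (forall v, v \in a :: Q') ->
  path e a Q' -> deg e a <= deg e z ->
  (forall w, w != z -> ~~ e w z -> deg e w <= deg e a) -> False.
Proof.
move=> e_sym e_irr hq hposa hno s0 eQ hu hsp hpath haz hmax.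
set Q := a :: Q' in hu hsp eQ.
have pred_ltn i m : 0 < i < m -> i.-1 < m by lia.
pose pre x := nth a Q (index x Q).-1.
(* For [x] in [A] the edge from the predecessor of [x] to [x] is not inside [s], so the exchange at
   this edge keeps [s] intact. The first vertex of [s] is allowed, its predecessor being outside
   [s]. *)
pose A := [set x | e a x] :\: [set x in behead s].
have xidx x : x \in A -> 0 < index x Q < size Q.
  rewrite !inE index_mem hsp andbT => /andP[_ ax] /=.
  by rewrite (_ : a == x = false) //; apply: contraTF ax => /eqP->; rewrite e_irr.
have pre_inj : {in A &, injective pre}.
  move=> x y xA yA /eqP; have := xidx x xA; have := xidx y yA.
  move=> hy hx; rewrite nth_uniq ?pred_ltn // => /eqP h.
  have {}h : index x Q = index y Q.
    by move: hx hy => /andP[/prednK <- _] /andP[/prednK <- _]; rewrite h.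
  by rewrite -(nth_index a (hsp x)) -(nth_index a (hsp y)) h.
have pre_z x : x \in A -> ~~ e (pre x) z.
  move=> xA; apply/negP => hz; apply: hno.
  have /andP[i0 iQ] := xidx x xA.
  have eQi : Q = take (index x Q) Q ++ drop (index x Q) Q by rewrite cat_take_drop.
  have [t et] : exists t, take (index x Q) Q = a :: t.
    by rewrite /Q; case: (index x _) i0 => // m _; exists (take m Q').
  have [t' et'] : exists t', drop (index x Q) Q = x :: t'.
    by exists (drop (index x Q).+1 Q); rewrite (drop_nth a) // nth_index.
  have epre : pre x = last a t.
    have -> : pre x = last a (a :: t).
      by rewrite -et /pre -nth_last size_takel 1?ltnW // nth_take //; lia.
    by [].
  have ez : z = last x t'.
    have -> : z = last a Q by [].
    by rewrite eQi last_cat et'.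
  move: (eQi); rewrite et et' => eQ2.
  have [hp1 [hp2 hp3]] : path e a t /\ e (last a t) x /\ path e x t'.
    by move: hpath; case: eQ2 => ->; rewrite cat_path /= => /and3P[].
  have hax : e a x by move: xA; rewrite !inE => /andP[].
  have hcz : e (last a t) (last x t') by rewrite -epre -ez.
  have [c1 c2] := crossing_cycle e_sym hp1 hp3 hax hcz.
  (* The exchange reverses one side of the cut. Of the two cycles given by [crossing_cycle], the one
     that leaves the side containing [s] unreversed is taken. *)
  have hxs : (index x Q <= size p3) || (size p3 + size s <= index x Q).
    have xnb : x \notin behead s by move: xA; rewrite !inE => /andP[].
    rewrite -eQ !index_cat; case: ifP => xp3; first by rewrite ltnW // index_mem.
    case: ifP => xs; last by rewrite addnA leq_addr orbT.
    suff -> : index x s = 0 by rewrite addn0 leqnn.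
    move: xnb xs; clear; case: s => //= y s h.
    by rewrite inE (negPf h) orbF => /eqP ->; rewrite eqxx.
  case/orP: hxs => hx.
    have ed : x :: t' = drop (index x Q) p3 ++ s ++ p1.
      rewrite -et' -[X in drop _ X]eQ drop_cat; case: ltnP => // h3.
      by rewrite (drop_oversize h3) (eqP hx : _ - _ = 0) drop0.
    apply: (@hamiltonian_through_infix _ _ (rev (a :: t) ++ drop (index x Q) p3) s p1);
      rewrite -catA -ed.
    - by rewrite cat_uniq rev_uniq (eq_has (mem_rev _)) -cat_uniq -eQ2.
    - exact: c1.
    - by move=> v; have := hsp v; rewrite eQ2 !mem_cat mem_rev.
  have hx3 : size p3 <= index x Q by apply: leq_trans (leq_addr _ _) hx.
  have ed : a :: t = p3 ++ s ++ take (index x Q - size p3 - size s) p1.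
    rewrite -et -[X in take _ X]eQ !take_cat ltnNge hx3 /= ltnNge.
    by rewrite leq_subRL // hx.
  apply: (@hamiltonian_through_infix _ _ p3 s
    (take (index x Q - size p3 - size s) p1 ++ rev (x :: t')));
    rewrite !(catA s) catA -ed.
  - by rewrite cat_uniq rev_uniq has_rev -cat_uniq -eQ2.
  - exact: c2.
  - by move=> v; have := hsp v; rewrite eQ2 !mem_cat mem_rev.
have pre_neq x : x \in A -> pre x != z.
  move=> xA; have := xidx x xA; rewrite /z /pre (last_nth a) -/Q => h.
  rewrite nth_uniq ?pred_ltn //.
  by move: h => /andP[/prednK <-]; rewrite /= ltnS => /ltn_eqF ->.
pose W := pre @: A.
have cW : #|W| = #|A| by apply: card_in_imset.
have cA : deg e a <= #|A| + (size s).-1.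
  rewrite /deg /A -(cardsID [set x in behead s]) addnC leq_add2l.
  apply: leq_trans (subset_leq_card (subsetIr _ _)) _.
  by rewrite cardsE -size_behead card_size.
have cWz : #|W| + (deg e z).+1 <= #|T|.
  have -> : (deg e z).+1 = #|z |: [set y | e z y]| by rewrite cardsU1 inE e_irr.
  rewrite -cardsUI [X in _ + X](_ : _ = 0) ?addn0 ?max_card //.
  apply/eqP; rewrite cards_eq0 -subset0; apply/subsetP => w; rewrite !inE.
  case/andP => /imsetP[x xA ->]; rewrite (negPf (pre_neq x xA)) /=.
  by rewrite e_sym (negPf (pre_z x xA)).
have hW w : w \in W -> deg e w <= deg e a.
  by case/imsetP => x xA ->; apply: hmax; [exact: pre_neq|exact: pre_z].
case: (leqP (size s) (deg e a)) => hs.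
  (* With this i, i + |s| = deg a + 1, so [W] consists of at least i vertices of degree less than i
     + |s|. As deg a <= deg z, [cWz] gives 2i + |s| <= |T|, contradicting Posa's condition. *)
  have := hposa (deg e a - (size s).-1).
  rewrite (_ : deg e a - (size s).-1 + size s = (deg e a).+1); last by lia.
  have : #|W| <= #|[set x | deg e x < (deg e a).+1]|.
    by apply/subset_leq_card/subsetP => w /hW; rewrite inE ltnS.
  by move=> h1 h2; have := h2 _ _; lia.
have := hposa 1 isT; rewrite add2n => /(_ hq); rewrite ltnS leqn0 cards_eq0.
by move/eqP/setP/(_ a); rewrite !inE add1n ltnS ltnW.
Qed.

Lemma complete_hamiltonian_through e s : (forall x y, x != y -> e x y) ->
  0 < size s -> 1 < #|T| -> uniq s -> hamiltonian_through e s.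
Proof.
move=> he s0 hT hu; pose p := [seq x <- enum T | x \notin s]; exists p.
have hup : uniq (s ++ p).
  rewrite cat_uniq hu filter_uniq ?enum_uniq // andbT.
  by apply/hasPn => x; rewrite mem_filter => /andP[].
have hsp v : v \in s ++ p.
  by rewrite mem_cat mem_filter mem_enum andbT orbN.
split=> //; have : #|T| = size (s ++ p).
  by rewrite -(card_uniqP hup); apply/esym/eq_card => v; rewrite !inE hsp.
move: p hup {hsp hu} => p; case: s s0 => // x s _; rewrite /= rcons_path => hu hs.
have hpair : pairwise (fun x y => x != y) (x :: s ++ p) by rewrite -uniq_pairwise.
have := sub_pairwise he hpair; move/pairwise_sorted => /= -> /=.
apply: he; move: hu hs => /andP[hx _]; case: (s ++ p) hx => [|y c] /=.
  by move=> _ hs; rewrite hs in hT.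
by move=> hx _; apply: contraNneq hx => <-; exact: mem_last.
Qed.

(* Induction on the number of non-adjacent pairs: a pair with maximal degree sum
   is joined first. *)
Theorem posa_hamiltonian_through e s : symmetric e -> irreflexive e ->
  0 < size s -> (size s).+2 <= #|T| -> uniq s -> sorted e s ->
  posa_rel (size s) e -> hamiltonian_through e s.
Proof.
pose N (f : rel T) := [set w : T * T | (w.1 != w.2) && ~~ f w.1 w.2].
move=> + + s0 hT hu; have [m] := ubnP #|N e|; elim: m e => // m IH e hm e_sym e_irr hs hposa.
have [N0|[w0 w0N]] := set_0Vmem (N e).
  apply: complete_hamiltonian_through => //; last by lia.
  move=> x y xy; have : (x, y) \notin N e by rewrite N0 inE.
  by rewrite inE /= xy /= negbK.
have [[u v] uvN hmax] := arg_maxnP (P := [in N e]) (fun w => deg e w.1 + deg e w.2) w0N.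
have /andP[/= uv euv] : ((u, v).1 != (u, v).2) && ~~ e (u, v).1 (u, v).2.
  by move: uvN; rewrite !inE.
pose e' x y := [|| e x y, (x == u) && (y == v) | (x == v) && (y == u)].
have e'_sym : symmetric e'.
  by move=> x y; rewrite /e' e_sym; congr (_ || _); rewrite orbC ![_ && (x == _)]andbC.
have e'_irr : irreflexive e'.
  move=> x; rewrite /e' e_irr /= andbC orbb; apply/negbTE; apply: contra uv.
  by move=> /andP[/eqP <- /eqP <-].
have sub_e x y : e x y -> e' x y by rewrite /e' => ->.
have hN : #|N e'| < m.
  apply: leq_trans (proper_card _) hm; apply/properP; split.
    apply/subsetP => -[x y]; rewrite !inE /= => /andP[->] /=.
    by apply: contra; exact: sub_e.
  by exists (u, v); rewrite !inE /= ?uv // /e' !eqxx orbT.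
have hposa' : posa_rel (size s) e'.
  move=> i i0 hi; apply: leq_ltn_trans (hposa i i0 hi).
  apply/subset_leq_card/subsetP => x; rewrite !inE; apply: leq_ltn_trans.
  by apply/subset_leq_card/subsetP => y; rewrite !inE; exact: sub_e.
have [] := IH e' hN e'_sym e'_irr _ hposa'; first exact: sub_sorted sub_e _ hs.
move=> p [hup hcp hsp]; apply: NNPP => hno.
have hbad : ~~ cycle e (s ++ p) by apply/negP => h; apply: hno; exists p.
have hT3 : 2 < #|T| by apply: leq_trans hT; rewrite !ltnS.
case es : s (s0) => // [x s'] _.
move: (hcp) (hbad) hs; rewrite es /= !rcons_cat !cat_path.
move=> /andP[_ h2] h3 h4; move: h3; rewrite h4 /= => h3.
(* Since [s] is a path of [e], the added edge is used after it. Cutting the cycle there leaves a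
   Hamiltonian path [Q] of [e] containing [s] as a block. *)
have [p1 [y [p2 [ep e'y ey]]]] := path_first_failure h2 h3.
have [p3 ep3] : exists p3, y :: p2 = rcons p3 x.
  case: (lastP p2) ep => [|p4 z] ep; [exists [::]|exists (y :: p4)];
  by move/(congr1 (last x)): ep; rewrite !last_rcons last_cat /= ?last_rcons => ->.
have {ep} ep : p = p1 ++ p3.
  by move: ep; rewrite ep3 -rcons_cat => /rcons_inj[].
set y0 := last (last x s') p1 in e'y ey.
pose Q := p3 ++ s ++ p1.
have eQrot : Q = rot (size (s ++ p1)) (s ++ p) by rewrite ep catA rot_size_cat.
have [Q' eQ] : exists Q', Q = y :: Q'.
  rewrite /Q es; case: p3 ep3 {ep eQrot Q} => [|z p3] /= [-> _]; last by eexists.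
  by exists (s' ++ p1).
have lQ : last y Q' = y0 by rewrite -[LHS]/(last y (y :: Q')) -eQ /Q es !last_cat /=.
have huQ : uniq Q by rewrite eQrot rot_uniq.
have hspQ v' : v' \in Q by rewrite eQrot mem_rot.
have hcQ : cycle e' Q by rewrite eQrot rot_cycle.
have sQ : size Q = #|T|.
  by rewrite -(card_uniqP huQ); apply/eq_card => z; rewrite !inE hspQ.
have huv : (y0 == u) && (y == v) || (y0 == v) && (y == u).
  by move: e'y; rewrite /e' (negPf ey).
have hpQ : path e y Q'.
  move: (huQ) (hcQ) (sQ); rewrite eQ /= rcons_path => hu' /andP[hp' _] sQ'.
  apply: (sorted_but_ends (e' := e')) => //; first by rewrite -ltnS sQ'.
  move=> a b; rewrite /e' lQ; case/or3P => [->//|/andP[/eqP-> /eqP->]|/andP[/eqP-> /eqP->]].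
    by case/orP: huv => /andP[/eqP-> /eqP->]; rewrite !eqxx ?orbT.
  by case/orP: huv => /andP[/eqP-> /eqP->]; rewrite !eqxx ?orbT.
have hyy : y0 != y by case/orP: huv => /andP[/eqP-> /eqP->]; rewrite // eq_sym.
have hsum a b : a != b -> ~~ e a b -> deg e a + deg e b <= deg e y + deg e y0.
  move=> hab heab; have := hmax (a, b); rewrite inE /= hab heab => /(_ isT) h.
  apply: leq_trans h _.
  by case/orP: huv => /andP[/eqP-> /eqP->]; rewrite // addnC.
(* [crossing_contra] starts at the end of smaller degree; in the other case [Q] and [s] are
   reversed. *)
case: (leqP (deg e y) (deg e y0)) => hd.
  apply: (@crossing_contra e s p3 p1 y Q') => //; rewrite ?lQ -?eQ //.
  by move=> w h5 h6; have := hsum w y0 h5 h6; rewrite leq_add2r.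
have eR : rev Q = y0 :: rev (belast y Q') by rewrite eQ rev_last lQ.
apply: (@crossing_contra e (rev s) (rev p1) (rev p3) y0 (rev (belast y Q'))) => //.
- by rewrite size_rev.
- by rewrite size_rev.
- by move=> /(hamiltonian_through_rev e_sym).
- by rewrite size_rev.
- by rewrite -eR /Q !rev_cat catA.
- by rewrite -eR rev_uniq.
- by move=> w; rewrite -eR mem_rev.
- by rewrite -lQ rev_path_sym.
- by rewrite -lQ last_rev_belast lQ ltnW.
- move=> w; rewrite -lQ last_rev_belast lQ => h5 h6.
  by have := hsum w y h5 h6; rewrite addnC leq_add2l.
Qed.

End Posa.

(** * Consequences of the Posa condition *)

Definition posa q (G : sgraph) := posa_rel q (@edge G).

(** For i > q - q' the condition for [q] at i - (q - q') has the same degree bound. For smaller i,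
    the condition for [q] at 1 already excludes degrees up to q, hence all those below i + q'. *)
Lemma posa_mono q q' (G : sgraph) : q' <= q -> q.+2 <= #|G| -> posa q G -> posa q' G.
Proof.
move=> hq hG h i i0 hi; case: (leqP i (q - q')) => hi'.
  have := h 1 isT; rewrite muln1 add2n => /(_ hG) h1.
  apply: leq_ltn_trans (leq_trans h1 i0).
  by apply/subset_leq_card/subsetP => x; rewrite !inE => /leq_trans -> //; lia.
have := h (i - (q - q')); rewrite (_ : i - (q - q') + q = i + q'); last by lia.
by move=> h1; apply: leq_trans (h1 _ _) _; lia.
Qed.

Section Deletion.
Variables (G : sgraph) (S : {set G}).

Lemma card_del : #|del S| = #|G| - #|S|.
Proof. by rewrite card_sig -(cardsC S) addKn; apply: eq_card. Qed.

Lemma leq_deg_del (x : del S) : #|nbh (val x) :\: S| <= #|nbh x|.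
Proof.
rewrite -[leqRHS](card_imset _ val_inj); apply/subset_leq_card/subsetP => y.
rewrite !inE => /andP[yS xy]; have yC : y \in ~: S by rewrite inE.
by apply/imsetP; exists (Sub y yC); rewrite // inE.
Qed.

(** Deleting [S] lowers each degree by at most |S|, which is exactly what the degree bound loses. *)
Lemma posa_del q : #|S| <= q -> posa q G -> posa (q - #|S|) (del S).
Proof.
move=> hS h i i0; rewrite card_del => hi.
have {}hi : 2 * i + q <= #|G| by have := max_card (mem S); lia.
apply: leq_ltn_trans (h i i0 hi).
rewrite -[leqLHS](card_imset _ val_inj); apply/subset_leq_card/subsetP.
move=> _ /imsetP[x + ->]; rewrite !inE => hx.
have : #|nbh (val x)| <= #|nbh (val x) :\: S| + #|S|.
  by rewrite -(cardsID S (nbh (val x))) addnC leq_add2l subset_leq_card ?subsetIr.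
by have := leq_deg_del x; move: hx; rewrite /deg -/(nbh _) -/(nbh _); lia.
Qed.

Lemma del_path (c : seq (del S)) : 
  (uniq (map val c) = uniq c) * (cycle (@edge G) (map val c) = cycle (@edge (del S)) c).
Proof. by rewrite (map_inj_uniq val_inj); split=> //; rewrite cycle_map. Qed.

End Deletion.

Lemma posa_hamiltonian_path_ext (G : sgraph) (s : seq G) :
  is_path s -> (size s).+2 <= #|G| -> posa (size s) G ->
  exists p, ham_cycle (s ++ p).
Proof.
case/and3P => s0 hu hs hG hp.
have {}s0 : 0 < size s by rewrite lt0n size_eq0.
have [p [h1 h2 h3]] :=
  posa_hamiltonian_through (@edge_sym G) (@edge_irrefl G) s0 hG hu hs hp.
exists p; split=> //; rewrite /is_cycle h1 h2 !andbT.
have <- : #|G| = size (s ++ p).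
  by rewrite -(card_uniqP h1); apply/eq_card => v; rewrite !inE h3.
by apply: leq_trans hG; rewrite !ltnS.
Qed.

Lemma posa_hamiltonian (G : sgraph) : 3 <= #|G| -> posa 1 G -> hamiltonian G.
Proof.
move=> hG hp; have /card_gt0P[x _] : 0 < #|G| by lia.
have [//|p hc] := @posa_hamiltonian_path_ext G [:: x] _ hG hp.
by exists (x :: p).
Qed.

Lemma next_cat_mem (T : eqType) (a b : seq T) x y : uniq (a ++ x :: y :: b) ->
  next (a ++ x :: y :: b) x = y.
Proof.
move=> hu; have -> : a ++ x :: y :: b = rotr (size a) (x :: y :: b ++ a).
  by rewrite -[x :: y :: b ++ a]/((x :: y :: b) ++ a) rotr_size_cat.
rewrite next_rotr /= ?eqxx //.
by move: hu; rewrite uniq_catC.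
Qed.

Lemma posa_path_hamiltonian k (G : sgraph) : k.+3 <= #|G| -> posa k.+1 G ->
  path_hamiltonian k G.
Proof.
move=> hG hp s hs sk; have sk1 : size s <= k.+1 by lia.
have [||p hc] := posa_hamiltonian_path_ext hs; first by lia.
  exact: posa_mono hp.
exists (s ++ p); split=> //; split; first by move=> x; rewrite mem_cat => ->.
have /andP[_ /andP[hu _]] := hc.1.
have H a b : s = a ++ b -> sorted (cycle_edge (s ++ p)) b.
  elim: b a => // x b IH a es; case: b IH es => // y b IH es /=.
  have -> : cycle_edge (s ++ p) x y.
    apply/and3P; split; rewrite ?es ?mem_cat ?inE ?eqxx ?orbT //.
    by rewrite -catA /= next_cat_mem ?eqxx // ; move: hu; rewrite es -catA.
  by apply: (IH (rcons a x)); rewrite cat_rcons.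
exact: (H [::]).
Qed.

Section AddEdge.
Variables (G : sgraph) (u v : G).
Hypothesis uv : u != v.

Definition add_edge_rel : rel G :=
  fun x y => [|| edge x y, (x == u) && (y == v) | (x == v) && (y == u)].

Lemma add_edge_sym : symmetric add_edge_rel.
Proof.
move=> x y; rewrite /add_edge_rel edge_sym; congr (_ || _).
by rewrite orbC ![_ && (x == _)]andbC.
Qed.

Lemma add_edge_irrefl : irreflexive add_edge_rel.
Proof.
move=> x; rewrite /add_edge_rel edge_irrefl /= andbC orbb; apply/negbTE.
by apply: contra uv => /andP[/eqP <- /eqP <-].
Qed.

Definition add_edge : sgraph := SGraph add_edge_sym add_edge_irrefl.

Lemma posa_add_edge q : posa q G -> posa q add_edge.
Proof.
move=> h i i0 hi; apply: leq_ltn_trans (h i i0 hi).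
apply/subset_leq_card/subsetP => x; rewrite !inE; apply: leq_ltn_trans.
by apply/subset_leq_card/subsetP => y; rewrite !inE => hy; apply/orP; left.
Qed.

End AddEdge.

(* A Hamiltonian cycle through the added edge [uv] is a Hamiltonian path of
   [G] from [u] to [v], closed up by [uv]. *)
Lemma posa_hamiltonian_connected (G : sgraph) : 4 <= #|G| -> posa 2 G ->
  hamiltonian_connected G.
Proof.
move=> hG hp u v uv.
have [|p [/and3P[hs hu hc] hsp]] :=
  @posa_hamiltonian_path_ext (add_edge uv) [:: u; v] _ hG (@posa_add_edge G u v uv 2 hp).
  by rewrite /is_path /= inE uv /edge /= /add_edge_rel !eqxx orbT.
move: hc; rewrite /= rcons_path => /and3P[_ hc hl].
have pne : p != [::] by apply: contraTneq hG => p0; rewrite p0 /= in hs.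
have hlp : last v p \in p by case: p pne {hs hu hc hl hsp} => //= x p _; exact: mem_last.
move: hu; rewrite /= inE negb_or => /and3P[/andP[_ up] vp hup].
have hpath : path (@edge G) v (rcons p u).
  rewrite rcons_path; apply/andP; split.
    apply: (sub_in_path (P := [pred x | x != u])) hc.
    - move=> x y /negPf xu /negPf yu; rewrite /edge /= /add_edge_rel xu yu andbF.
      by rewrite !orbF.
    - rewrite /= eq_sym uv; apply/allP => x xp /=.
      by apply: contraNneq up => <-.
  move: hl; rewrite /edge /= /add_edge_rel => /or3P[//|/andP[/eqP h _]|/andP[/eqP h _]].
  + by rewrite h (negPf up) in hlp.
  + by rewrite h (negPf vp) in hlp.
exists (rcons (rev p) v); split; last by rewrite last_rcons.
have er : u :: rcons (rev p) v = rev (v :: rcons p u).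
  by rewrite rev_cons rev_rcons.
rewrite er; split.
  apply/and3P; split; first by rewrite -size_eq0 size_rev.
  - rewrite rev_uniq /= mem_rcons inE eq_sym (negPf uv) vp rcons_uniq up.
    exact: hup.
  - by rewrite rev_last /= (rev_path_sym (@edge_sym G)).
move=> x; rewrite mem_rev inE mem_rcons inE; have := hsp x.
by rewrite !inE orbCA.
Qed.

Section Cone.
Variable G : sgraph.

(** Removing the apex [None] from a Hamiltonian cycle of the cone leaves a Hamiltonian path of
    [G]. *)
Definition cone_rel : rel (option G) := fun a b =>
  match a, b with
  | Some x, Some y => edge x y
  | None, None => false
  | _, _ => true
  end.

Lemma cone_sym : symmetric cone_rel.
Proof. by case=> [x|] [y|] //=; rewrite edge_sym. Qed.

Lemma cone_irrefl : irreflexive cone_rel.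
Proof. by case=> [x|] //=; rewrite edge_irrefl. Qed.

Definition cone : sgraph := SGraph cone_sym cone_irrefl.

Lemma posa_cone : posa 0 G -> posa 1 cone.
Proof.
move=> h i i0; rewrite card_option => hi.
apply: leq_ltn_trans (h i i0 _); last by lia.
rewrite -[leqRHS](card_imset _ (@Some_inj _)); apply/subset_leq_card/subsetP => -[x|].
  rewrite inE => hx; apply/imsetP; exists x => //; rewrite inE addn0.
  move: hx; rewrite addn1 ltnS; apply: leq_trans.
  rewrite /deg -(card_imset _ (@Some_inj _)).
  set B := [set _ | _ in _]; have -> : #|B|.+1 = #|None |: B|.
    by rewrite cardsU1 (_ : None \notin B) //; apply/imsetP => -[].
  apply/subset_leq_card/subsetP => y /setU1P[->|/imsetP[z + ->]]; rewrite !inE //.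
rewrite inE /deg; suff : #|G| <= #|[set y : cone | edge (None : cone) y]| by lia.
rewrite -cardsT -(card_imset _ (@Some_inj _)).
by apply/subset_leq_card/subsetP => _ /imsetP[y _ ->]; rewrite !inE.
Qed.

End Cone.

Lemma posa_traceable (G : sgraph) : 2 <= #|G| -> posa 0 G -> traceable G.
Proof.
move=> hG hp; have hcone : 3 <= #|cone G| by rewrite card_option.
have [//|p [/and3P[hs hu hc] hsp]] :=
  @posa_hamiltonian_path_ext (cone G) [:: None] _ hcone (posa_cone hp).
move: hu => /= /andP[hN hup].
have [p' ep] : exists p', p = map Some p'.
  exists (pmap id p); elim: p hN {hs hc hsp hup} => //= -[x|] p IH; rewrite inE //=.
  by move=> hN; rewrite -IH.
move: hc; rewrite /= rcons_path => /andP[hc _].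
exists p'; split.
  apply/and3P; split.
  - by apply: contraTneq hs => e; rewrite ep e.
  - by move: hup; rewrite ep map_inj_uniq //; exact: Some_inj.
  - move: hc; rewrite ep; case: p' {ep} => //= x p' hc.
    by move: hc; rewrite path_map; apply: sub_path.
move=> x; have := hsp (Some x); rewrite inE /= ep mem_map //; exact: Some_inj.
Qed.

Lemma traceable_connected (G : sgraph) : traceable G -> connected_graph G.
Proof.
case=> -[|x s] [/and3P[//= _ _ hs] hsp] y z.
have h w : connect (@edge G) x w.
  by apply: (path_connect hs); exact: hsp.
by apply: connect_trans (h z); rewrite (sym_connect_sym (@edge_sym G)).
Qed.

Lemma posa_k_hamiltonian k (G : sgraph) : k.+3 <= #|G| -> posa k.+1 G ->
  k_hamiltonian k G.
Proof.
move=> hG hp S hS; apply: posa_hamiltonian; first by rewrite card_del; lia.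
apply: posa_mono (posa_del _ hp); rewrite ?card_del; lia.
Qed.

Lemma posa_k_hamiltonian_connected k (G : sgraph) : k.+3 <= #|G| -> posa k.+1 G ->
  k_hamiltonian_connected k G.
Proof.
move=> hG hp S hS; apply: posa_hamiltonian_connected; first by rewrite card_del; lia.
apply: posa_mono (posa_del _ hp); rewrite ?card_del; lia.
Qed.

(** After deleting at most k vertices Posa's condition for q = 0 survives, so even a Hamiltonian
    path remains. *)
Lemma posa_k_connected k (G : sgraph) : k.+2 <= #|G| -> posa k G ->
  k_connected k.+1 G.
Proof.
move=> hG hp S hS; apply/traceable_connected/posa_traceable.
  by rewrite card_del; lia.
apply: posa_mono (posa_del _ hp); rewrite ?card_del; lia.
Qed.

(** * Chorded cycles *)

Lemma handshake_few_cliques t r D (G : sgraph) : clique_free r.+2 G ->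
  (forall v : G, #|nbh v| <= D) ->
  t.+1 * num_cliques t.+1 G <= #|G| * tcl t r D.
Proof.
move=> /clique_freeP free hD; rewrite -kinT -kin_handshake.
apply: (@leq_trans (\sum_(v in [set: G]) tcl t r D)); last first.
  by rewrite sum_nat_const cardsT.
by apply: leq_sum => v vT; apply: kin_degree_leq => //; rewrite setTI.
Qed.

Lemma turan_clique_free r m : 0 < r -> clique_free r.+1 (turan r m).
Proof.
move=> r0 K /cliqueP hK cK; pose f (i : turan r m) : 'I_r := Ordinal (ltn_pmod i r0).
have : {in K &, injective f}.
  move=> i j iK jK /(congr1 val) /= e; apply/eqP; apply: contraT => ij.
  by have := hK i j iK jK ij; rewrite /edge /= /turan_rel e eqxx.
move/card_in_imset => e; have := max_card (mem (f @: K)).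
by rewrite card_ord e cK ltnn.
Qed.

(** No link needs to be identified: [tcl_turan] bounds all cliques from below, Zykov's theorem
    bounds those avoiding a vertex from above, so each vertex is in at least as many cliques as the
    last increment of [tcl]. *)
Lemma turan_handshake t r m : 0 < r ->
  m.+1 * tcl t r.-1 (tdeg r m) <= t.+1 * num_cliques t.+1 (turan r m.+1).
Proof.
case: r => // r _; rewrite -kinT -kin_handshake.
have free := clique_freeP (@turan_clique_free r.+1 m.+1 isT).
apply: (@leq_trans (\sum_(v in [set: turan r.+1 m.+1]) tcl t r (tdeg r.+1 m))).
  by rewrite sum_nat_const cardsT card_ord.
apply: leq_sum => v vT; rewrite -(leq_add2l (kin t.+1 (setT :\ v))) -kin_del //.
have : tcl t.+1 r.+1 m.+1 <= kin t.+1 [set: turan r.+1 m.+1].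
  by rewrite kinT; apply: tcl_turan.
rewrite tclS; apply: leq_trans; rewrite leq_add2r.
have -> : tcl t.+1 r.+1 m = tcl t.+1 r.+1 #|setT :\ v|.
  by congr tcl; have := cardsD1 v setT; rewrite inE cardsT card_ord => -[].
by apply: zykov; apply/eqP; rewrite -leqn0 -free kinS // subsetT.
Qed.

(** A convex function vanishing at 0: the tangent at [a] is compared at 0 and at [b]. *)
Lemma tcl_superlinear t r a b : a <= b -> b * tcl t.+1 r a <= a * tcl t.+1 r b.
Proof.
move=> ab; have := tcl_tangent t r a 0; have := tcl_tangent t r a b.
rewrite tclS0 muln0 addn0 add0n; set s := tcl t _ _; set g := tcl _ _ a; set g' := tcl _ _ b.
rewrite -(subnKC ab); move: (b - a) => c; nia.
Qed.

(** If all degrees were at most D = [tdeg r m] - 1, then counting pairs of a vertex and a clique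
    through it, in [G] and in [turan r m.+1], would reduce the claim by superlinearity to (m+2)D <=
    (m+1)(D+1), which holds as D <= m. *)
Lemma exists_high_degree t r m (G : sgraph) : 0 < r -> #|G| = m.+2 ->
  clique_free r.+1 G ->
  num_cliques t.+2 (turan r m.+1) < num_cliques t.+2 G ->
  exists v : G, tdeg r m <= #|nbh v|.
Proof.
case: r => // r _ cG free hlt; apply/existsP; apply: contraLR hlt.
rewrite negb_exists => /forallP hd; rewrite -leqNgt.
have := @turan_handshake t.+1 r.+1 m isT; rewrite [r.+1.-1]/=.
case hD : (tdeg r.+1 m) => [|D].
  have /card_gt0P[v _] : 0 < #|G| by rewrite cG.
  by have := hd v; rewrite hD.
have := @handshake_few_cliques t.+1 r D G free; rewrite cG => H1 H2.
have {}H1 : t.+2 * num_cliques t.+2 G <= m.+2 * tcl t.+1 r D.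
  by apply: H1 => v; have := hd v; rewrite hD -ltnNge.
rewrite -(leq_pmul2l (ltn0Sn t.+1)); apply: leq_trans H1 (leq_trans _ H2).
have := tcl_superlinear t r (leqnSn D).
have Dm : D.+1 <= m by rewrite -hD leq_subr.
set g := tcl _ _ D; set g' := tcl _ _ D.+1 => h.
rewrite -(leq_pmul2l (ltn0Sn D)); nia.
Qed.

Lemma iter_next (T : eqType) (x : T) c i : uniq (x :: c) -> i <= size c ->
  iter i (next (x :: c)) x = nth x (x :: c) i.
Proof.
move=> hu; elim: i => // i IH hi; rewrite iterS IH 1?ltnW //.
by rewrite next_nth mem_nth 1?ltnS 1?ltnW // index_uniq // ltnS ltnW.
Qed.

Section ChordedThroughVertex.
Variables (G : sgraph) (c : seq G) (v : G) (l : nat).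
Hypotheses (hc : is_cycle c) (vc : v \notin c) (l5 : 5 <= l) (lc : l <= (size c).+1).

Let N := [set x in c | edge v x].

(** The cycle is [v] followed by the l - 1 vertices of [c] from [x] on; its chord joins [v] to the
    first or second successor of [x]. As l >= 5, neither of these is the last vertex of the
    cycle. *)
Lemma chorded_cycle_through x : x \in N -> iter (l - 2) (next c) x \in N ->
  (next c x \in N) || (next c (next c x) \in N) ->
  exists c' : seq G, chorded_cycle c' /\ size c' = l.
Proof.
rewrite inE => /andP[xc vx]; rewrite inE => /andP[_]; have /and3P[_ hu hcyc] := hc.
have [i c1 ec] := rot_to xc.
have nE : next c =1 next (x :: c1) by move=> y; rewrite -ec next_rot.
rewrite !nE (eq_iter nE).
have hu1 : uniq (x :: c1) by rewrite -ec rot_uniq.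
have hc1 : cycle (@edge G) (x :: c1) by rewrite -ec rot_cycle.
have vc1 : v \notin x :: c1 by rewrite -ec mem_rot.
have sc1 : (size c1).+1 = size c by rewrite -[RHS](size_rot i) ec.
rewrite iter_next //; last by clear -l5 lc sc1; lia.
set w := take (l - 2) c1.
have sw : size w = l - 2 by rewrite size_takel //; clear -l5 lc sc1; lia.
have hlast : last x w = nth x (x :: c1) (l - 2).
  by rewrite (last_nth x) sw -[x :: w]/(take (l - 2).+1 (x :: c1)) nth_take.
rewrite -hlast => hvl hchord.
have ec1 : c1 = w ++ drop (l - 2) c1 by rewrite cat_take_drop.
have hcyc' : cycle (@edge G) (v :: x :: w).
  rewrite /= rcons_path vx edge_sym hvl andbT.
  by move: hc1; rewrite /= rcons_path ec1 cat_path => /andP[/andP[-> _] _].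
have huc : uniq (v :: x :: w).
  have : subseq (x :: w) (x :: c1) by rewrite /= eqxx take_subseq.
  move=> hsub; rewrite cons_uniq (subseq_uniq hsub hu1) andbT.
  by apply: contra vc1; exact: mem_subseq hsub v.
have [sc11 sc12] : 1 <= size c1 /\ 2 <= size c1 by clear -l5 lc sc1; lia.
have nx1 : next (x :: c1) x = nth x (x :: c1) 1 := iter_next hu1 sc11.
have nx2 : next (x :: c1) (next (x :: c1) x) = nth x (x :: c1) 2 := iter_next hu1 sc12.
rewrite nx2 nx1 {nx1 nx2} !inE in hchord.
have [y1 [y2 [y3 [d ew]]]] : exists y1 y2 y3 d, w = [:: y1, y2, y3 & d].
  by case: (w) sw => [|y1 [|y2 [|y3 d]]] /= hw; last (by exists y1, y2, y3, d);
    exfalso; clear -l5 hw; lia.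
exists (v :: x :: w); split; last by rewrite /= sw; clear -l5; lia.
split; first by rewrite /is_cycle /= sw; apply/and3P; split=> //; clear -l5; lia.
move: hchord; rewrite ec1 ew /=; move: huc; rewrite ew => huc.
have n0 : next [:: v, x, y1, y2, y3 & d] v = x by exact: (@next_cat_mem _ [::] _ v x huc).
have n2 : next [:: v, x, y1, y2, y3 & d] y1 = y2.
  exact: (@next_cat_mem _ [:: v; x] _ y1 y2 huc).
have n3 : next [:: v, x, y1, y2, y3 & d] y2 = y3.
  exact: (@next_cat_mem _ [:: v; x; y1] _ y2 y3 huc).
move: huc; rewrite /= !inE !negb_or -!andbA.
case/and5P => _ v1 v2 v3 /and5P[_ x1 x2 _ _].
move=> hchord.
case/orP: hchord => /andP[_ hv]; [exists v, y1|exists v, y2];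
  apply/and4P; split; rewrite // ?inE ?eqxx ?orbT // /cycle_edge n0.
  by rewrite n2 (negPf x1) [y2 == v]eq_sym (negPf v2) !andbF.
by rewrite n3 (negPf x2) [y3 == v]eq_sym (negPf v3) !andbF.
Qed.

(* If no chorded cycle of length [l] passes through [v], then [N] and the sets
   [P1], [P2] of first and second successors of the [x] in [N] whose [l - 2]-th
   successor is in [N] are disjoint. *)
Lemma chorded_cycle_through_many : 3 * size c < 5 * #|N| ->
  exists c' : seq G, chorded_cycle c' /\ size c' = l.
Proof.
have /and3P[hs hu hcyc] := hc => h5; apply: NNPP => hno.
pose nx := next c; have nxK : cancel nx (prev c) by exact: prev_next.
have nx_inj : injective nx := can_inj nxK.
pose C := [set x in c]; have cC : #|C| = size c by rewrite cardsE; apply/card_uniqP.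
have NC : N \subset C by apply/subsetP => x; rewrite !inE => /andP[].
pose M := iter (l - 2) (prev c) @: N.
have MC : M \subset C.
  apply/subsetP => _ /imsetP[x + ->]; rewrite !inE => /andP[xc _].
  by elim: (l - 2) => //= k; rewrite mem_prev.
have itK : cancel (iter (l - 2) (prev c)) (iter (l - 2) nx).
  elim: (l - 2) => // k IH x; rewrite [iter k.+1 nx _]iterSr iterS.
  by rewrite /nx next_prev // IH.
have cM : #|M| = #|N| by apply: card_imset; apply: can_inj itK.
pose P := N :&: M.
have hP x : x \in P -> (nx x \notin N) && (nx (nx x) \notin N).
  rewrite inE => /andP[xN /imsetP[y yN ey]]; rewrite -negb_or; apply/negP => h.
  apply: hno; apply: (chorded_cycle_through xN) => //.
  by rewrite ey -/nx itK.
have cP : #|N| + #|N| <= size c + #|P|.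
  rewrite -{2}cM -cardsUI -cC leq_add2r subset_leq_card //.
  by rewrite subUset NC MC.
pose P1 := nx @: P; pose P2 := nx @: P1.
have c1 : #|P1| = #|P| by apply: card_imset.
have c2 : #|P2| = #|P| by rewrite -c1; apply: card_imset.
have P1C : P1 \subset C.
  apply/subsetP => _ /imsetP[x /setIP[xN _] ->]; have := subsetP NC x xN.
  by rewrite !inE mem_next.
have P2C : P2 \subset C.
  apply/subsetP => _ /imsetP[x xP ->]; have := subsetP P1C x xP.
  by rewrite !inE mem_next.
have d1 : N :&: P1 = set0.
  apply/setP => y; rewrite in_setI in_set0; apply/negP => /andP[yN /imsetP[x xP ey]].
  by have /andP[] := hP x xP; rewrite -ey yN.
have d2 : (N :|: P1) :&: P2 = set0.
  apply/setP => y; rewrite in_setI in_set0 in_setU; apply/negP.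
  move=> /andP[+ /imsetP[z /imsetP[x xP ez] ey]].
  case/orP => [yN|/imsetP[x' xP' ey']].
    by have /andP[_] := hP x xP; rewrite -ez -ey yN.
  have /nx_inj ex : nx x' = nx z by rewrite -ey -ey'.
  have /andP[+ _] := hP x xP; rewrite -ez -ex.
  by have /setIP[->] := xP'.
(* Disjointness gives |N| + 2|P| <= |c|; with |P| >= 2|N| - |c| this is 5|N| <= 3|c|, the origin of
   the 3/5. *)
have : #|N :|: P1 :|: P2| <= size c by rewrite -cC subset_leq_card // !subUset NC P1C P2C.
have := cardsUI (N :|: P1) P2; rewrite d2 cards0 addn0 => ->.
have := cardsUI N P1; rewrite d1 cards0 addn0 => ->.
by rewrite c1 c2; clear -cP h5; lia.
Qed.

End ChordedThroughVertex.

(** * Graphs without a chorded cycle of length four *)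

Lemma kin1 (G : sgraph) (A : {set G}) : kin 1 A = #|A|.
Proof.
have := kin_handshake 0 A; rewrite mul1n => <-.
by rewrite -sum1_card; apply: eq_bigr => v _; rewrite kin0.
Qed.

Lemma kin_small (G : sgraph) t (A : {set G}) : #|A| < t -> kin t A = 0.
Proof.
move=> hA; apply: eq_card0 => K; rewrite !inE; apply/negP => /and3P[/subset_leq_card h /eqP h' _].
by rewrite h' leqNgt hA in h.
Qed.

Section NoChordedFourCycle.
Variable G : sgraph.
Hypothesis no_chord : forall c : seq G, chorded_cycle c -> size c <> 4.

Lemma codegree_le1 (x y : G) : edge x y -> #|nbh x :&: nbh y| <= 1.
Proof.
move=> xy; rewrite leqNgt; apply/negP => /card_gt1P[a [b [+ + ab]]].
rewrite !inE => /andP[xa ya] /andP[xb yb].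
have ne (u w : G) : edge u w -> u != w.
  by move=> h; apply: contraTneq h => ->; rewrite edge_irrefl.
have hu : uniq [:: x; a; y; b].
  rewrite /= !inE !negb_or (ne _ _ xa) (ne _ _ xy) (ne _ _ xb) ab (ne _ _ yb).
  by rewrite eq_sym (ne _ _ ya).
apply: (no_chord (c := [:: x; a; y; b])) => //; split.
  by apply/and3P; split=> //=; rewrite xa edge_sym ya yb edge_sym xb.
exists x, y; rewrite !inE !eqxx !orbT xy /= /cycle_edge.
have -> : next [:: x; a; y; b] x = a by exact: (@next_cat_mem _ [::] _ x a hu).
have -> : next [:: x; a; y; b] y = b by exact: (@next_cat_mem _ [:: x; a] [::] y b hu).
by rewrite eq_sym (negPf (ne _ _ ya)) eq_sym (negPf (ne _ _ xb)) !andbF.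
Qed.

Lemma num_cliques4 t : num_cliques t.+4 G = 0.
Proof.
apply/eqP; rewrite -kinT -(eqn_pmul2l (ltn0Sn t.+3)) muln0 -kin_handshake.
rewrite sum_nat_eq0; apply/forall_inP => v _.
rewrite -(eqn_pmul2l (ltn0Sn t.+2)) muln0 -kin_handshake.
rewrite sum_nat_eq0; apply/forall_inP => x; rewrite setTI inE => vx.
by rewrite kin_small //; apply: leq_ltn_trans (codegree_le1 vx) _.
Qed.

Lemma num_cliques3_leq : 3 * num_cliques 3 G <= num_cliques 2 G.
Proof.
rewrite -(leq_pmul2l (ltn0Sn 1)) -!kinT -!kin_handshake big_distrr /=.
apply: leq_sum => v _; rewrite -kin_handshake setTI kin1 -sum1_card.
by apply: leq_sum => x; rewrite inE kin1 => /codegree_le1.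
Qed.

(** D is the maximum degree, attained at v. A neighbour of v shares at most one neighbour with v, so
    its degree is at most n + 1 - D; the n - D other vertices have degree at most D. *)
Lemma num_edges_leq : exists D, 2 * num_cliques 2 G <= #|G| * D /\
  2 * num_cliques 2 G + 2 * D * D <= D * (2 * #|G| + 1).
Proof.
have hsum : 2 * num_cliques 2 G = \sum_(v : G) #|nbh v|.
  rewrite -kinT -kin_handshake; apply: eq_big => v; first by rewrite inE.
  by rewrite kin1 setTI.
case: (posnP #|G|) => hG.
  exists 0; rewrite hsum big1 ?muln0 // => v _.
  by have := card0_eq hG v; rewrite inE.
have /card_gt0P[v0 _] := hG.
have [v _ hv] := arg_maxnP (P := xpredT) (fun v : G => #|nbh v|) (erefl : xpredT v0).
exists #|nbh v|; rewrite hsum; split.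
  by rewrite -sum_nat_const; apply: leq_sum => x _; exact: hv.
have h1 x : x \in nbh v -> #|nbh x| <= #|G| + 1 - #|nbh v|.
  rewrite inE => /codegree_le1; have := subset_leq_card (subsetT (nbh v :|: nbh x)).
  rewrite cardsT.
  by have := cardsUI (nbh v) (nbh x); lia.
have h2 : #|nbh v| + #|~: nbh v| = #|G| := cardsC _.
have : \sum_(x : G) #|nbh x| <=
  #|nbh v| * (#|G| + 1 - #|nbh v|) + #|~: nbh v| * #|nbh v|.
  rewrite (bigID (mem (nbh v))) /=; apply: leq_add.
    by rewrite -sum_nat_const; apply: leq_sum => x /h1.
  rewrite -sum_nat_const.
  rewrite (eq_bigl (mem (~: nbh v))); last by move=> x; rewrite !inE.
  by apply: leq_sum => x _; exact: hv.
move: (#|nbh v|) (#|~: nbh v|) h2 => D D' h2; move: (#|G|) h2 => n h2.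
rewrite -h2 (_ : D + D' + 1 - D = D' + 1); nia.
Qed.

End NoChordedFourCycle.

Lemma tcl2E r m : tcl 2 r m = \sum_(x < m) tdeg r x.
Proof. by rewrite tclE; apply: eq_bigr => x _; rewrite tcl1. Qed.

Lemma tcl2_le r r' m : 0 < r <= r' -> tcl 2 r m <= tcl 2 r' m.
Proof. by move=> h; rewrite !tcl2E; apply: leq_sum => x _; exact: tdeg_le. Qed.

Lemma tcl2_lower r m : r.-1 * (m * m.-1) <= 2 * r * tcl 2 r m.
Proof.
have := sum_arith 0 m; rewrite muln0 add0n => <-.
rewrite tcl2E mulnCA -mulnA leq_mul2l /= !big_distrr /=.
by apply: leq_sum => x _; exact: leq_mul_tdeg.
Qed.

Lemma tcl2_quadratic r m : 3 <= r -> (r = 3 -> 25 <= m) -> (r = 4 -> 10 <= m) -> 4 <= m ->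
  m.+1 * m.+2 <= 4 * (tcl 2 r m + 1) + 3.
Proof.
move=> r3 h3 h4 m4; case: (eqVneq r 3) => [e|n3].
  by have := tcl2_lower r m; rewrite e /=; have := h3 e; case: m {h3 h4 m4} => //= m; nia.
case: (eqVneq r 4) => [e|n4].
  by have := tcl2_lower r m; rewrite e /=; have := h4 e; case: m {h3 h4 m4} => //= m; nia.
have /(tcl2_le m) : 0 < 5 <= r by lia.
case: (leqP 8 m) => hm h5.
  by have := tcl2_lower 5 m; case: m hm h5 {h3 h4 m4} => //= m; nia.
move: h5; rewrite tcl2E.
have : m \in [:: 4; 5; 6; 7] by rewrite !inE; lia.
by rewrite !inE => /or4P[] /eqP ->; rewrite !big_ord_recr big_ord0 /= /tdeg /=; lia.
Qed.

Lemma tcl2_connected r d : 2 <= r -> d <= tcl 2 r d + 1.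
Proof.
move=> r2; elim: d => // d IH; rewrite tclS tcl1.
case: d IH => [|d] IH; first by rewrite addn1.
have : 1 <= tdeg r d.+1.
  apply: leq_trans (tdeg_le d.+1 (r := 2) _); last by lia.
  by rewrite /tdeg; lia.
by lia.
Qed.

(** Serves to pass from edges to triangles: 3k^3 <= k^2 <= [tcl 2] + 1 <= 3 [tcl 3] + 2 forces k^3
    <= [tcl 3]. *)
Lemma tcl2_leq_tcl3 r m : 3 <= r -> tcl 2 r m <= 3 * tcl 3 r m + 1.
Proof.
move=> r3; elim: m => [|m IH]; first by rewrite !tclS0.
case: (leqP m 1) => m1.
  have -> : tcl 2 r m.+1 = \sum_(x < m.+1) tdeg r x by rewrite tcl2E.
  case: m m1 {IH} => [|[|]] // _; rewrite !big_ord_recr big_ord0 /=.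
  - have := leq_subr (0 %/ r) 0; rewrite -/(tdeg r 0); lia.
  - have := leq_subr (0 %/ r) 0; have := leq_subr (1 %/ r) 1.
    rewrite -/(tdeg r 0) -/(tdeg r 1); lia.
rewrite !tclS tcl1.
have := @tcl2_connected r.-1 (tdeg r m); rewrite (_ : 1 < r.-1); last by lia.
move=> /(_ isT).
have : 2 <= tdeg r m.
  apply: leq_trans (tdeg_le m (r := 3) _); last by lia.
  by rewrite /tdeg; lia.
lia.
Qed.

(** The parabola D(2n+1) - 2D^2 is at most (2n+1)^2/8, so 16e <= 4n(n+1) + 1; the 3 in the second
    hypothesis is absorbed by integrality. *)
Lemma vertex_parabola_leq e D n z : 2 * e + 2 * D * D <= D * (2 * n + 1) ->
  n * n.+1 <= 4 * (z + 1) + 3 -> e <= z + 1.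
Proof.
move=> h1 h2; have [h3 _] := nat_Cauchy (4 * D) (2 * n + 1).
rewrite -!mulnn in h3.
by have h4 : 16 * e <= (2 * n + 1) * (2 * n + 1); lia.
Qed.

Lemma no_chorded_4_cycle_few_cliques t r (G : sgraph) : 3 <= r ->
  (r = 3 -> 26 <= #|G|) -> (r = 4 -> 11 <= #|G|) -> 4 <= #|G| ->
  (forall c : seq G, chorded_cycle c -> size c <> 4) -> few_cliques t r 1 G.
Proof.
move=> r3 h3 h4 hG no_chord; rewrite /few_cliques.
have he : num_cliques 2 G <= tcl 2 r #|G|.-1 + 1.
  have [D [hD1 hD2]] := num_edges_leq no_chord.
  (* For n = 4 the value [tcl 2 r 3] = 3 just fails the quadratic bound, 20 against 19, so the
     possible D are inspected. *)
  case: (eqVneq #|G| 4) => [e4|n4].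
    have : 6 <= 2 * tcl 2 r 3.
      have /(tcl2_le 3) : 0 < 5 <= r by lia.
      by rewrite [tcl 2 5 3]tcl2E !big_ord_recr big_ord0 /= /tdeg /=; lia.
    rewrite e4 /= in hD1 hD2 *.
    have : D <= 4 by nia.
    by case: D hD1 hD2 => [|[|[|[|[|]]]]] //=; lia.
  have := @tcl2_quadratic r #|G|.-1 r3; rewrite (_ : #|G|.-1.+1 = #|G|); last by lia.
  move=> H; have {}H : #|G| * #|G|.+1 <= 4 * (tcl 2 r #|G|.-1 + 1) + 3.
    by apply: H; [move=> /h3|move=> /h4|]; lia.
  exact: vertex_parabola_leq hD2 H.
case: t => [|[|t]].
- by rewrite tcl1.
- have := num_cliques3_leq no_chord; have := tcl2_leq_tcl3 #|G|.-1 r3; lia.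
- by rewrite num_cliques4.
Qed.

(** * A vertex of large degree and a long cycle avoiding it *)

Lemma hamiltonian_del (G : sgraph) (S : {set G}) : hamiltonian (del S) ->
  exists c : seq G, is_cycle c /\ forall x, (x \in c) = (x \notin S).
Proof.
case=> c [/and3P[hs hu hc] hsp]; exists (map val c); split.
  by rewrite /is_cycle size_map !del_path; apply/and3P.
move=> x; apply/mapP/idP => [[y _ ->]|xS]; first by have := valP y; rewrite inE.
have xC : x \in ~: S by rewrite inE.
by exists (Sub x xC).
Qed.

(* The second vertex of [S], if any, is one of minimum degree. *)
Lemma hamiltonian_avoiding t r (G : sgraph) (v : G) : 1 < r -> clique_free r.+1 G ->
  (forall i e, 0 < i -> 2 * i + 3 <= #|G| -> 2 * (i + e).+1 <= #|G| -> e <= 1 ->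
     deletable_after_min r #|G| i e) ->
  5 <= #|G| -> ~~ few_cliques t r 1 G ->
  exists S : {set G}, [/\ v \in S, #|S| <= 2 & hamiltonian (del S)].
Proof.
move=> r1 free hdel hG hfew.
have [w0 w0v] : exists w0, w0 \in [set~ v].
  by apply/card_gt0P; have := cardsC [set v]; rewrite cards1; lia.
have [u uv hu] := arg_minnP (P := [in [set~ v]]) (fun x : G => #|nbh x|) w0v.
have {uv} uv : u != v by move: uv; rewrite !inE.
have {}hu x : x != v -> #|nbh u| <= #|nbh x| by move=> xv; apply: hu; rewrite !inE.
(* If 2 deg u > n, all degrees in G-v exceed n/2 - 1 and Posa's condition there is vacuous.
   Otherwise 2 deg u <= n is kept as a hypothesis for the deletion that begins with [u]. *)
case: (ltnP #|G| (2 * #|nbh u|)) => hd.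
  exists [set v]; rewrite set11 cards1; split=> //; apply: posa_hamiltonian.
    by rewrite card_del cards1; lia.
  move=> i i0; rewrite card_del cards1 => hi.
  rewrite (_ : #|_| = 0) //; apply: eq_card0 => x; rewrite !inE; apply/negbTE.
  have := hu (val x); have := valP x; rewrite !inE => -> /(_ isT) hx.
  have := leq_deg_del x; have := cardsID [set v] (nbh (val x)).
  have : #|nbh (val x) :&: [set v]| <= 1.
    by rewrite -[leqRHS](cards1 v) subset_leq_card ?subsetIr.
  by rewrite /deg -/(nbh _) -/(nbh _); lia.
exists [set u; v]; rewrite set22 cards2 uv; split=> //; apply: posa_hamiltonian.
  by rewrite card_del cards2 uv; lia.
move=> i i0; rewrite card_del cards2 uv => hi; rewrite ltnNge; apply: contra hfew => hcard.
have [x hx] : exists x : del [set u; v], #|nbh x| < i + 1.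
  have /card_gt0P[x] := leq_trans i0 hcard; rewrite inE => hx.
  by exists x.
have hdeg (y : del [set u; v]) : #|nbh (val y) :\ u| <= #|nbh y|.+1.
  have := leq_deg_del y.
  have -> : nbh (val y) :\: [set u; v] = (nbh (val y) :\ u) :\ v.
    by apply/setP => z; rewrite !inE negb_or -andbA andbCA.
  rewrite [X in _ -> X <= _](cardsD1 v); case: (v \in _); rewrite ?add1n ?add0n ?ltnS //.
  by move/leqW.
have hui : #|nbh u| <= i.+2.
  have := valP x; rewrite !inE negb_or => /andP[xu xv].
  apply: leq_trans (hu _ xv) _; have := hdeg x.
  rewrite (cardsD1 u (nbh (val x))) => h; apply: leq_trans (leq_add (leq_b1 _) h) _.
  by move: hx; rewrite add1n addn1 !ltnS.
have hset : i <= #|[set x in ~: [set u] | #|nbh x :\ u| <= i.+1]|.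
  apply: leq_trans hcard _; rewrite -[leqLHS](card_imset _ val_inj).
  apply/subset_leq_card/subsetP => _ /imsetP[y + ->]; rewrite !inE => hy.
  have := valP y; rewrite !inE negb_or => /andP[-> _] /=.
  by apply: leq_trans (hdeg y) _; move: hy; rewrite addn1.
(* The excess e is at most 1 because a vertex of degree at most i in G-u-v has degree at most i + 2
   in G, and [u] has no larger degree. *)
apply: (@low_degree_after_min_few_cliques t r i (#|nbh u| - i.+1) G u) => //.
- by apply: hdel => //; lia.
- by lia.
- by lia.
- by lia.
Qed.

Lemma chorded_of_hamiltonian (G : sgraph) (c : seq G) (v : G) : ham_cycle c ->
  3 <= #|nbh v| -> chorded_cycle c.
Proof.
move=> [hc hsp] hv; split=> //; have /and3P[_ hu _] := hc.
have : ~~ (nbh v \subset [set next c v; prev c v]).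
  apply/negP => /subset_leq_card; rewrite cards2; case: (_ != _); lia.
case/subsetPn => w; rewrite !inE negb_or => vw /andP[wn wp].
exists v, w; rewrite !hsp vw /= /cycle_edge !hsp /= negb_or eq_sym wn /=.
by apply: contra wp => /eqP <-; rewrite prev_next.
Qed.

(* A variant of [tcl] that computes, [bigop] being locked. *)
Fixpoint tcl_seq (t r m : nat) : nat :=
  if t is t'.+1 then sumn [seq tcl_seq t' r.-1 (tdeg r x) | x <- iota 0 m] else 1.

Lemma tcl_seqE t r m : tcl_seq t r m = tcl t r m.
Proof.
elim: t r m => // t IH r m; rewrite tclE /= sumnE big_map.
rewrite -(big_mkord xpredT (fun x => tcl t r.-1 (tdeg r x))).
by rewrite /index_iota subn0; apply: eq_bigr => x _.
Qed.

Lemma tcl_small t r m : m < t -> tcl t r m = 0.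
Proof.
elim: t r m => // t IH r m mt; rewrite tclE big1 // => x _; apply: IH.
by apply: leq_ltn_trans (leq_subr _ _) _; apply: leq_trans (ltn_ord x) _.
Qed.

(** The second inequality says that [v] is adjacent to more than 3/5 of a cycle on n - 2 vertices
    even after losing one neighbour to the second deleted vertex; degree 3 provides a chord of a
    Hamiltonian cycle. *)
Lemma exists_vertex_through t r (G : sgraph) : 3 <= r -> clique_free r.+1 G ->
  (r = 3 -> 26 <= #|G|) -> (r = 4 -> 11 <= #|G|) -> 5 <= #|G| ->
  num_cliques t.+2 (turan r #|G|.-1) < num_cliques t.+2 G ->
  exists v : G, 3 <= #|nbh v| /\ (6 <= #|G| -> 3 * (#|G| - 2) < 5 * #|nbh v|.-1).
Proof.
move=> r3 free h3 h4 hG hlt; have r0 : 0 < r by lia.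
have cG : #|G| = (#|G| - 2).+2 by lia.
have : num_cliques t.+2 (turan r (#|G| - 2).+1) < num_cliques t.+2 G.
  by rewrite (_ : (#|G| - 2).+1 = #|G|.-1) //; lia.
case/(exists_high_degree r0 cG free) => v hv.
have rle r' : 0 < r' <= r -> tdeg r' (#|G| - 2) <= #|nbh v|.
  by move/(tdeg_le (#|G| - 2)) => h; exact: leq_trans h hv.
case: (eqVneq r 3) => [e|n3].
  by exists v; have := rle 3; have := h3 e; rewrite r3 /tdeg; lia.
case: (eqVneq r 4) => [e|n4].
  by exists v; have := rle 4; have := h4 e; rewrite e /tdeg; lia.
have := rle 5; rewrite (_ : 0 < 5 <= r); last by lia.
move=> /(_ isT) h5.
(* For n = 7 and r = 5 the guaranteed degree 4 gives only 15 < 15, so degree 5 is needed; it comes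
   from a direct count. *)
case: (eqVneq #|G| 7) => [e7|n7]; last by exists v; move: h5; rewrite /tdeg; lia.
case: (leqP 6 r) => r6.
  by exists v; have := rle 6; rewrite r6 e7 /tdeg; lia.
have e5 : r = 5 by lia.
suff : [exists v : G, 5 <= #|nbh v|] by case/existsP => w hw; exists w; rewrite e7; lia.
apply: contraLR hlt; rewrite negb_exists => /forallP hd; rewrite -leqNgt e7 e5 /=.
rewrite e5 in free.
apply: leq_trans (tcl_turan t.+2 6 (isT : 0 < 5)).
rewrite -(leq_pmul2l (ltn0Sn t.+1)).
have := @handshake_few_cliques t.+1 4 4 G free; rewrite e7 => H.
apply: leq_trans (H _) _ => {H} [w|]; first by have := hd w; rewrite -ltnNge.
(* A link has at most 4 vertices, so only the four values t <= 3 remain, and they are computed. *)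
case: (leqP 5 t.+1) => ht; first by rewrite tcl_small // muln0.
by rewrite -!tcl_seqE; move: t ht => [|[|[|[|t]]]] //.
Qed.

Lemma deletable_hamiltonian r n i : 3 <= r -> (r = 3 -> 26 <= n) -> (r = 4 -> 11 <= n) ->
  0 < i -> 2 * i + 1 <= n -> deletable r n 1 i.
Proof.
move=> r3 h3 h4 i0 hi.
case: (eqVneq r 3) => [e|n3]; first by rewrite e; apply: deletable3 => //; exact: h3.
case: (eqVneq r 4) => [e|n4].
  by rewrite e; apply: deletable4 => //; right; exact: h4.
by apply: (@deletable_le 5); [lia|apply: deletable5 => //; left].
Qed.

Lemma deletable_after_min_hamiltonian r n i e : 3 <= r ->
  (r = 3 -> 26 <= n) -> (r = 4 -> 11 <= n) -> 6 <= n ->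
  0 < i -> 2 * i + 3 <= n -> 2 * (i + e).+1 <= n -> e <= 1 ->
  deletable_after_min r n i e.
Proof.
move=> r3 h3 h4 n6 i0 hi he e1.
case: (eqVneq r 3) => [er|n3].
  by rewrite er; apply: deletable_after_min3 => //; exact: h3.
case: (eqVneq r 4) => [er|n4].
  by rewrite er; apply: deletable_after_min4 => //; exact: h4.
by apply: (@deletable_after_min_le 5); [lia|apply: deletable_after_min5].
Qed.

Lemma few_cliques_or_posa t r q (G : sgraph) : 0 < r -> clique_free r.+1 G ->
  0 < #|G| -> (forall i, 0 < i -> 2 * i + q <= #|G| -> deletable r #|G| q i) ->
  ~~ few_cliques t r q G -> q.+2 <= #|G| /\ posa q G.
Proof.
move=> r0 free G0 hdel hfew; split.
  (* If n <= q + 1, every degree is below 1 + q, and deleting a single vertex already gives the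
     bound. *)
  rewrite ltnNge; apply: contra hfew => hG.
  apply: (@low_degree_few_cliques t r q 1 G) => //.
    by exists 1 => //; rewrite mul1n add1n /= leq_addl.
  rewrite (_ : [set x | _] = setT) ?cardsT //; apply/setP => x; rewrite !inE.
  have : #|x |: nbh x| <= #|G| by exact: max_card.
  by rewrite cardsU1 nbh_irr add1n add1n => /leq_trans; apply.
move=> i i0 hi; rewrite ltnNge; apply: contra hfew => hcard.
apply: (@low_degree_few_cliques t r q i G) => //; first exact: hdel.
by lia.
Qed.

Lemma chorded_pancyclic_of_many_cliques t r (G : sgraph) : 3 <= r ->
  clique_free r.+1 G -> (r = 3 -> 26 <= #|G|) -> (r = 4 -> 11 <= #|G|) ->
  ~~ few_cliques t r 1 G ->
  num_cliques t.+2 (turan r #|G|.-1) < num_cliques t.+2 G -> chorded_pancyclic G.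
Proof.
move=> r3 free h3 h4 hfew hlt m /andP[m4 mG].
case: (eqVneq m 4) => [->|nm4].
  apply: NNPP => hno; move/negP: hfew; apply.
  apply: no_chorded_4_cycle_few_cliques => //; first by lia.
  by move=> c h1 h2; apply: hno; exists c.
have G5 : 5 <= #|G| by lia.
have [v [hv3 hv]] := exists_vertex_through r3 free h3 h4 G5 hlt.
(* Cycles through [v] are built from a cycle on n - 1 or n - 2 vertices, which guarantees lengths up
   to n - 1 only; length n comes from a Hamiltonian cycle. *)
case: (eqVneq m #|G|) => [->|nmG].
  have hdel i : 0 < i -> 2 * i + 1 <= #|G| -> deletable r #|G| 1 i.
    exact: deletable_hamiltonian.
  have [r0 G0] : 0 < r /\ 0 < #|G| by lia.
  have [hG hp] := few_cliques_or_posa r0 free G0 hdel hfew.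
  have [c hc] := posa_hamiltonian hG hp.
  exists c; split; first exact: chorded_of_hamiltonian hc hv3.
  case: hc => /and3P[_ /card_uniqP <- _] hsp.
  by apply: eq_card => x; rewrite !inE hsp.
have G6 : 6 <= #|G| by lia.
have hdel i e : 0 < i -> 2 * i + 3 <= #|G| -> 2 * (i + e).+1 <= #|G| -> e <= 1 ->
    deletable_after_min r #|G| i e.
  exact: deletable_after_min_hamiltonian.
have [S [vS cS hS]] := hamiltonian_avoiding v (ltnW r3) free hdel G5 hfew.
have [c [hc hcS]] := hamiltonian_del hS.
have sc : size c = #|G| - #|S|.
  have /and3P[_ /card_uniqP <- _] := hc; rewrite -(cardsC S) addKn.
  by apply: eq_card => x; rewrite !inE hcS.
apply: (chorded_cycle_through_many (v := v) hc).
- by rewrite hcS vS.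
- by lia.
- by rewrite sc; lia.
have hN : #|nbh v| <= #|[set x in c | edge v x]| + #|S :\ v|.
  apply: leq_trans (leq_card_setU _ _); apply/subset_leq_card/subsetP => x.
  rewrite !inE hcS => vx; rewrite vx andbT; case: (x \in S) => //=.
  by rewrite andbT; apply: contraTneq vx => ->; rewrite edge_irrefl.
have := hv G6; have := cardsD1 v S; rewrite vS sc; lia.
Qed.

(** * The extremal graphs *)

Lemma num_cliques_iso t (G H : sgraph) : isomorphic G H ->
  num_cliques t G = num_cliques t H.
Proof.
case=> f [[f' fK f'K] fe]; apply/eqP; rewrite eqn_leq; apply/andP; split; rewrite -[leqRHS]kinT.
  by apply: (num_cliques_embed (can_inj fK)) => // x y; rewrite fe.
by apply: (num_cliques_embed (can_inj f'K)) => // x y; rewrite -fe !f'K.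
Qed.

Lemma few_cliques_Gstar t r q (l : int) (G H : sgraph) : 3 <= r ->
  Gstar #|G| r l H -> `|(l + 1)%R| = q -> few_cliques t r q G ->
  num_cliques t.+2 G <= num_cliques t.+2 H.
Proof.
move=> r3 hH <- hfew; apply: leq_trans hfew _.
apply: leq_trans (Gstar_num_cliques t.+1 (ltnW r3) hH).
by apply: leq_add; apply: tcl_turan; lia.
Qed.

Lemma Gstar_pos n r l H : Gstar n r l H -> 0 < n.
Proof. by case=> _ <- [x _]; apply/card_gt0P; exists x. Qed.

Lemma Gstar_turan_plus_vertex n r l (H : sgraph) (P : {set H} -> Prop) :
  Gstar n r l H ->
  (forall x, isomorphic (induced (nbh x)) (turan r.-1 `|(l + 1)%R|) -> P (nbh x)) ->
  turan_plus_vertex n r P.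
Proof.
case=> _ _ [x [f [hf hN _]]] hP; exists x; split; last exact: hP.
by exists f.
Qed.

Lemma card_induced (G : sgraph) (A : {set G}) r m :
  isomorphic (induced A) (turan r m) -> #|A| = m.
Proof.
by case=> f [hf _]; have := bij_eq_card hf; rewrite card_ord card_sig => <-; apply: eq_card.
Qed.

(** With at most [r] vertices, every residue class has at most one element. *)
Lemma induced_turan_clique (G : sgraph) (A : {set G}) r m : m <= r ->
  isomorphic (induced A) (turan r m) ->
  forall u v, u \in A -> v \in A -> u != v -> edge u v.
Proof.
move=> mr [f [hf fe]] u v uA vA uv.
have <- : edge (f (Sub u uA)) (f (Sub v vA)) = edge u v by rewrite fe.
have hlt (i : turan r m) : i < r := leq_trans (ltn_ord i) mr.
rewrite /edge /= /turan_rel !modn_small //; apply: contra uv => /eqP/val_inj e.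
by have := bij_inj hf e => /(congr1 val) /= ->.
Qed.

Lemma rat_threshold k r n : 8 <= r ->
  (k%:R + 5 + 4 * (k%:R + 4) / (r%:R - 4) <= n%:R :> rat)%R ->
  (k + 5) * (r - 4) + 4 * (k + 4) <= n * (r - 4).
Proof.
move=> r8; have er : (r%:R - 4 = (r - 4)%:R :> rat)%R by rewrite natrB //; lia.
have r0 : (0 < (r - 4)%:R :> rat)%R by rewrite ltr0n; lia.
rewrite er -(ler_pM2r r0) mulrDl mulfVK; last by rewrite gt_eqF.
by rewrite -!natrD -!natrM -natrD ler_nat.
Qed.

Lemma deletable_traceable r n i : 3 <= r -> (r = 3 -> 20 <= n) ->
  0 < i -> 2 * i + 0 <= n -> deletable r n 0 i.
Proof.
move=> r3 h3 i0 hi.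
case: (eqVneq r 3) => [e|n3]; first by rewrite e; apply: deletable3 => //; exact: h3.
by apply: (@deletable_le 4); [lia|apply: deletable4 => //; left].
Qed.

Lemma deletable_hamiltonian_connected r n i : 3 <= r -> (r = 3 -> 32 <= n) ->
  (r = 4 -> 16 <= n) -> (r = 5 -> 10 <= n) ->
  0 < i -> 2 * i + 2 <= n -> deletable r n 2 i.
Proof.
move=> r3 h3 h4 h5 i0 hi.
case: (eqVneq r 3) => [e|n3]; first by rewrite e; apply: deletable3 => //; exact: h3.
case: (eqVneq r 4) => [e|n4].
  by rewrite e; apply: deletable4 => //; right; exact: h4.
case: (eqVneq r 5) => [e|n5].
  by rewrite e; apply: deletable5 => //; right; exact: h5.
by apply: (@deletable_le 6); [lia|exact: deletable6].
Qed.

Lemma deletable_threshold r n q i : 3 <= r -> (r = 3 -> 6 * q + 20 <= n) ->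
  (r = 4 -> 5 * q + 6 <= n) -> (5 <= r <= 7 -> 3 * q + 4 <= n) ->
  (8 <= r -> (q + 4) * (r - 4) + 4 * (q + 3) <= n * (r - 4)) ->
  0 < i -> 2 * i + q <= n -> deletable r n q i.
Proof.
move=> r3 h3 h4 h5 h8 i0 hi.
case: (eqVneq r 3) => [e|n3]; first by rewrite e; apply: deletable3 => //; exact: h3.
case: (eqVneq r 4) => [e|n4].
  by rewrite e; apply: deletable4 => //; right; exact: h4.
case: (leqP r 7) => r7.
  by apply: (@deletable_le 5); [lia|apply: deletable5 => //; right; lia].
by apply: deletable8 => //; [lia|exact: h8].
Qed.

Theorem corollary6p4 (G : sgraph) (n r t : nat)
  (hn : #|G| = n) (hr : 3 <= r) (ht : 2 <= t) (hfree : clique_free r.+1 G) :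
  (* (a) *)
  ((r = 3 -> 20 <= n) -> (4 <= r -> 1 <= n) ->
   ~ traceable G ->
   forall H : sgraph, Gstar n r (-1)%R H ->
   [/\ num_cliques t G <= num_cliques t H,
       isomorphic G H -> num_cliques t G = num_cliques t H &
       turan_plus_vertex n r (fun N : {set H} => #|N| = 0)]) /\
  (* (b) *)
  ((r = 3 -> 26 <= n) -> (r = 4 -> 11 <= n) -> (5 <= r -> 2 <= n) ->
   ~ hamiltonian G \/ (4 <= n /\ ~ chorded_pancyclic G) ->
   forall H : sgraph, Gstar n r 0%R H ->
   [/\ num_cliques t G <= num_cliques t H,
       isomorphic G H -> num_cliques t G = num_cliques t H &
       turan_plus_vertex n r (fun N : {set H} => #|N| = 1)]) /\
  (* (c) *)
  ((r = 3 -> 32 <= n) -> (r = 4 -> 16 <= n) -> (r = 5 -> 10 <= n) ->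
   (6 <= r -> 4 <= n) ->
   ~ hamiltonian_connected G ->
   forall H : sgraph, Gstar n r 1%R H ->
   [/\ num_cliques t G <= num_cliques t H,
       isomorphic G H -> num_cliques t G = num_cliques t H &
       turan_plus_vertex n r (fun N : {set H} =>
         #|N| = 2 /\ forall u v : H, u \in N -> v \in N -> u != v -> edge u v)]) /\
  (* (d) *)
  (forall k : nat,
   (r = 3 -> 6 * k + 26 <= n) -> (4 <= r <= 7 -> 5 * k + 11 <= n) ->
   (8 <= r -> (k%:R + 5 + 4 * (k%:R + 4) / (r%:R - 4) <= n%:R :> rat)%R) ->
   ~ path_hamiltonian k G ->
   forall H : sgraph, Gstar n r k%:Z%R H ->
   num_cliques t G <= num_cliques t H /\
   (isomorphic G H -> num_cliques t G = num_cliques t H)) /\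
  (* (e) *)
  (forall k : nat,
   (r = 3 -> 6 * k + 26 <= n) -> (4 <= r <= 7 -> 5 * k + 11 <= n) ->
   (8 <= r -> (k%:R + 5 + 4 * (k%:R + 4) / (r%:R - 4) <= n%:R :> rat)%R) ->
   ~ k_hamiltonian k G ->
   forall H : sgraph, Gstar n r k%:Z%R H ->
   num_cliques t G <= num_cliques t H /\
   (isomorphic G H -> num_cliques t G = num_cliques t H)) /\
  (* (f) *)
  (forall k : nat, 1 <= k ->
   (r = 3 -> 6 * k + 26 <= n) -> (r = 4 -> 5 * k + 11 <= n) ->
   (5 <= r <= 7 -> 3 * k + 7 <= n) ->
   (8 <= r -> (k%:R + 5 + 4 * (k%:R + 4) / (r%:R - 4) <= n%:R :> rat)%R) ->
   ~ k_hamiltonian_connected k G ->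
   forall H : sgraph, Gstar n r k%:Z%R H ->
   num_cliques t G <= num_cliques t H /\
   (isomorphic G H -> num_cliques t G = num_cliques t H)) /\
  (* (g) *)
  (forall k : nat, 1 <= k ->
   (r = 3 -> 6 * k + 14 <= n) -> (4 <= r <= 7 -> 5 * k + 1 <= n) ->
   (8 <= r -> 2 * k + 5 <= n) ->
   ~ k_connected k G ->
   forall H : sgraph, Gstar n r (k%:Z - 2)%R H ->
   num_cliques t G <= num_cliques t H /\
   (isomorphic G H -> num_cliques t G = num_cliques t H)).
Proof.
case: t ht => [|[|t]] // _.
have [r0 r1] : 0 < r /\ 1 < r by lia.
(* The argument shared by all properties except chorded pancyclicity: if [G] has more cliques than
   the extremal graph, it satisfies Posa's condition for q = l + 1, hence [P]. *)
have bound q (l : int) (P : Prop) :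
    (forall i, 0 < i -> 2 * i + q <= n -> deletable r n q i) ->
    (q.+2 <= #|G| -> posa q G -> P) -> ~ P -> `|(l + 1)%R| = q ->
    forall H, Gstar n r l H -> num_cliques t.+2 G <= num_cliques t.+2 H.
  move=> hdel hP nP el H hH; rewrite -hn in hdel hH.
  apply: (few_cliques_Gstar hr hH el) => //; apply/contraT => hfew; case: nP.
  have [h1 h2] := few_cliques_or_posa r0 hfree (Gstar_pos hH) hdel hfew.
  exact: hP.
have iso H := @num_cliques_iso t.+2 G H.
split; [|split; [|split; [|split; [|split; [|split]]]]].
- move=> h3 h4 hG H hH; split; last 1 first.
  + by apply: (Gstar_turan_plus_vertex hH) => x /card_induced.
  + apply: (bound 0 _ _ _ (@posa_traceable G) hG _ H hH) => // i i0 hi.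
    exact: deletable_traceable.
  + exact: iso.
- move=> h3 h4 h5 hG H hH; split; last 1 first.
  + by apply: (Gstar_turan_plus_vertex hH) => x /card_induced.
  + have hdel i : 0 < i -> 2 * i + 1 <= n -> deletable r n 1 i.
      exact: deletable_hamiltonian.
    case: hG => [hG|[n4 hG]].
      exact: (bound 1 _ _ hdel (@posa_hamiltonian G) hG _ H hH).
    rewrite leqNgt; apply/negP => hlt; case: hG; subst n.
    apply: (@chorded_pancyclic_of_many_cliques t r) => //.
      apply/negP => hfew; have := few_cliques_Gstar hr hH (erefl _) hfew.
      by rewrite leqNgt hlt.
    apply: leq_ltn_trans hlt; apply: leq_trans (Gstar_num_cliques _ r1 hH).
    exact: leq_addr.
  + exact: iso.
- move=> h3 h4 h5 h6 hG H hH; split; last 1 first.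
  + apply: (Gstar_turan_plus_vertex hH) => x hx; split.
      exact: card_induced hx.
    by apply: induced_turan_clique hx; lia.
  + apply: (bound 2 _ _ _ (@posa_hamiltonian_connected G) hG _ H hH) => // i i0 hi.
    exact: deletable_hamiltonian_connected.
  + exact: iso.
- move=> k h3 h4 h8 hG H hH; split; last exact: iso.
  apply: (bound k.+1 _ _ _ (@posa_path_hamiltonian k G) hG _ H hH); last by lia.
  move=> i i0 hi; apply: deletable_threshold => //; try lia.
  by move=> r8; have := rat_threshold r8 (h8 r8); rewrite !addSn !addnS.
- move=> k h3 h4 h8 hG H hH; split; last exact: iso.
  apply: (bound k.+1 _ _ _ (@posa_k_hamiltonian k G) hG _ H hH); last by lia.
  move=> i i0 hi; apply: deletable_threshold => //; try lia.
  by move=> r8; have := rat_threshold r8 (h8 r8); rewrite !addSn !addnS.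
- move=> k k1 h3 h4 h5 h8 hG H hH; split; last exact: iso.
  apply: (bound k.+1 _ _ _ (@posa_k_hamiltonian_connected k G) hG _ H hH); last by lia.
  move=> i i0 hi; apply: deletable_threshold => //; try lia.
  by move=> r8; have := rat_threshold r8 (h8 r8); rewrite !addSn !addnS.
- case=> // k _ h3 h4 h8 hG H hH; split; last exact: iso.
  apply: (bound k _ _ _ (@posa_k_connected k G) hG _ H hH); last by lia.
  move=> i i0 hi; apply: deletable_threshold => //; try lia.
  (* With [k] now one less than the connectivity, n >= 2k + 7 implies the condition of [deletable8]
     for q = k: for n = 2k + 7 the two sides agree at r = 8, and larger r only helps. *)
  move=> r8; have := h8 r8; rewrite -(@leq_pmul2r (r - 4)); last by lia.
  apply: leq_trans; have [u ->] : exists u, r = u + 8 by exists (r - 8); lia.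
  by rewrite (_ : u + 8 - 4 = u + 4); nia.
Qed.
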